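(* Let $(\mathbb F,\star)\in\{(\mathbb C,* ),(\mathbb R,\top)\}$ and let $E,Q,L\in\mathbb F^{n,n}$ with $E^\star Q=Q^\star E\ge0$ and $L+L^\star\le0$ be such that $P(\lambda)=\lambda E-LQ$ is a regular pencil of index at most one. Write $L=J-R$ with $J=-J^\star$, $R=R^\star\ge0$. Let a condensed form of $P(\lambda)$ as described in the context be given, with $\widetilde U,\widetilde X$, partition $(n_1,n_2,n_3,n_4)$ and blocks $Q_{ij},L_{ij}$, and let $R_{ij}$ denote the blocks of $\widetilde UR\widetilde U^\star$. Set $$R_0:=\begin{bmatrix} R_{11}&R_{12}&R_{14} \\ R_{21}&R_{22}&R_{24} \\ R_{41}&R_{42}&R_{44} \end{bmatrix},\quad L_3:=\begin{bmatrix} L_{31}&L_{32}&L_{33}&L_{34} \end{bmatrix},\quad Q_2:=\begin{bmatrix} Q_{12} \\ Q_{22} \\ 0 \\ Q_{42} \end{bmatrix}.$$ Then, for every $Y:=\begin{bmatrix} Y_1&Y_2&Y_4 \end{bmatrix}$ with $Y_j\in\mathbb F^{n_3,n_j}$ and $\operatorname{im}Y^\star\subseteq\operatorname{im}R_0$, setting $\widehat Y:=\begin{bmatrix} Y_1&Y_2&0&Y_4 \end{bmatrix}\in\mathbb F^{n_3,n}$, there exist $\Delta_R=\Delta_R^\star\in\mathbb F^{n,n}$ such that $R+\Delta_R\ge0$ and $$\|\Delta_R\|\le2\|Y\|+\Big(\big\|(R_0|_{\operatorname{im}R_0})^{-1}\big\|\,\|Y\|+2\big\|(R_0|_{\operatorname{im}R_0})^{-\frac12}\big\|\,\|Y\|^{\frac12}\Big)\big(\|R_{33}\|+\|Y\|\big),$$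 and $\Delta_J=-\Delta_J^\star\in\mathbb F^{n,n}$ with Frobenius norm bounded by $$\|\Delta_J\|_F\le2\big\|P_{\operatorname{im}Q_2}(L_3^\star+\widehat Y^\star)\big\|_F,$$ such that for every $s,t\in\mathbb C$ the pencil $\lambda E-(J+s\Delta_J-R-t\Delta_R)Q$ is regular and has the same Kronecker structure for the nonzero eigenvalues (including infinity) as $P(\lambda)$, and zero is a semisimple eigenvalue of $\lambda E-(J+\Delta_J-R-\Delta_R)Q$.
   Context: $*$ is conjugate transpose, $\top$ is transpose; $W\ge0$ ($W\le0$) means Hermitian (real symmetric) positive (negative) semidefinite. $\|\cdot\|$ is the spectral norm, $\|\cdot\|_F$ the Frobenius norm, $P_{\mathcal X}$ the orthogonal projection onto a subspace $\mathcal X$, and $R_0|_{\operatorname{im}R_0}$ the (positive definite) restriction of $R_0$ to $\operatorname{im}R_0$. A square pencil is regular if its determinant is not identically zero; its index is the size of the largest block associated with $\infty$ in its Kronecker canonical form (zero if $E$ is invertible). An eigenvalue is semisimple if all its Jordan blocks have size one (if zero is not an eigenvalue at all, it is counted as semisimple). Condensed form: $(n_1,n_2,n_3,n_4)$ is a partition of $n$ (zeros allowed), $\widetilde U\in\mathbb F^{n,n}$ is unitary, $\widetilde X\in\mathbb F^{n,n}$ is invertible, and with conformable partitioning $$\widetilde Q:=\widetilde UQ\widetilde X=\begin{bmatrix} Q_{11}&Q_{12}&0&0 \\ Q_{21}&Q_{22}&0&0 \\ 0&0&0&0 \\ Q_{41}&Q_{42}&0&I \end{bmatrix},\quad \widetilde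 E:=\widetilde UE\widetilde X=\begin{bmatrix} E_{11}&0&0&0 \\ E_{21}&E_{22}&0&0 \\ 0&0&I&0 \\ 0&0&0&0 \end{bmatrix},$$ $$\widetilde L:=\widetilde UL\widetilde U^\star=[L_{ij}]_{i,j=1}^4,\quad \widetilde A:=\widetilde ULQ\widetilde X=\begin{bmatrix} A_{11}&0&0&A_{14} \\ A_{21}&0&0&A_{24} \\ A_{31}&A_{32}&0&A_{34} \\ 0&0&0&A_{44} \end{bmatrix},$$ where $E_{11},E_{22},A_{11}$ are lower triangular and invertible, and $A_{44}$ and $\begin{bmatrix} Q_{11}&Q_{12} \\ Q_{21}&Q_{22} \end{bmatrix}$ are invertible. (Real matrices may be regarded as complex ones, with $\mathbb F=\mathbb C$.) *)

(* Defs.v *)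
From HB Require Import structures.
From mathcomp Require Export all_boot all_order all_algebra.
From mathcomp Require Export classical_sets reals.
From mathcomp.real_closed Require Export complex.

Set Implicit Arguments.
Unset Strict Implicit.
Unset Printing Implicit Defensive.

Export Order.TTheory GRing.Theory Num.Theory.
Global Open Scope ring_scope.
Global Open Scope sesquilinear_scope.

(* The two choices of ground field are realized inside 'M[K[i]]: a matrix over
   the reals is a complex matrix all of whose entries are real, and for such a
   matrix the conjugate transpose M^t* is the transpose M^T. *)
Variant ground_field := RealField | ComplexField.

Definition scalars (K : realType) (F : ground_field) : {pred K[i]} :=
  if F is RealField then Num.real else predT.
Arguments scalars : clear implicits.

Section Matrices.
Context {K : realType}.
Local Notation C := K[i].

(* For z in K[i], 0 <= z means that z is real and nonnegative. *)
Definition psdmx n (W : 'M[C]_n) : Prop :=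
  W^t* = W /\ forall x : 'cV[C]_n, 0 <= (x^t* *m W *m x) 0 0.

Definition nsdmx n (W : 'M[C]_n) : Prop :=
  W^t* = W /\ forall x : 'cV[C]_n, (x^t* *m W *m x) 0 0 <= 0.

Definition frobenius_norm m n (A : 'M[C]_(m, n)) : K :=
  Num.sqrt (\sum_i \sum_j Normc.normc (A i j) ^+ 2).

Definition euclidean_norm n (x : 'cV[C]_n) : K :=
  Num.sqrt (\sum_i Normc.normc (x i 0) ^+ 2).

Definition spectral_norm m n (A : 'M[C]_(m, n)) : K :=
  sup [set euclidean_norm (A *m x) | x in [set x | euclidean_norm x <= 1]].

(* MathComp works with row spaces, whereas im A is the column space of A: hence
   the transpositions below. *)
Definition im_sub m n p (A : 'M[C]_(m, n)) (B : 'M[C]_(m, p)) : bool :=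
  (A^T <= B^T)%MS.

Definition orthoproj_im m n (A : 'M[C]_(m, n)) : 'M[C]_m := (proj_ortho A^T)^T.

Definition im_onb m n (A : 'M[C]_(m, n)) : 'M[C]_(m, \rank A^T) :=
  (schmidt (row_base A^T))^T.

(* The matrix of A|_(im A) in the orthonormal basis im_onb A of im A; its
   spectral norm, and those of its functions, do not depend on the basis. *)
Definition restrict_im n (A : 'M[C]_n) : 'M[C]_(\rank A^T) :=
  (im_onb A)^t* *m A *m im_onb A.

(* The Hermitian positive semidefinite square root of a Hermitian positive
   semidefinite matrix A, from its spectral decomposition. *)
Definition sqrt_psd n (A : 'M[C]_n) : 'M[C]_n :=
  invmx (spectralmx A) *m diag_mx (map_mx sqrtC (spectral_diag A))
    *m spectralmx A.

(* A pencil z E - A is given by the pair (E, A). *)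
Definition regular_pencil n (E A : 'M[C]_n) : Prop :=
  \det ('X *: map_mx polyC E - map_mx polyC A) != 0 :> {poly C}.

(* A block of the Kronecker canonical form of a regular pencil: its eigenvalue,
   None standing for infinity, and its size. *)
Definition kblock : Type := (option C * nat)%type.

Definition jordan_block k (a : C) : 'M[C]_k :=
  \matrix_(i, j) (a *+ (i == j) + (i.+1 == j :> nat)%:R).

(* A block is z I - J(a) for a finite eigenvalue a, and z J(0) - I for
   infinity, where J(a) is an upper triangular Jordan block. *)
Definition kblock_E (b : kblock) : 'M[C]_(b.2) :=
  if b.1 is Some _ then 1%:M else jordan_block b.2 0.

Definition kblock_A (b : kblock) : 'M[C]_(b.2) :=
  if b.1 is Some a then jordan_block b.2 a else 1%:M.

Definition kblock_nth (bs : seq kblock) (i : nat) : kblock :=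
  nth (None, 0%N) bs i.

(* bs lists the blocks of a Kronecker canonical form of z E - A. Only regular
   pencils have one in this sense (singular blocks are not provided for), and
   bs is then unique up to reordering. *)
Definition kronecker_form n (E A : 'M[C]_n) (bs : seq kblock) : Prop :=
  all (fun b => 0 < b.2)%N bs /\
  exists (hn : (\sum_(i < size bs) (kblock_nth bs i).2)%N = n) (S T : 'M[C]_n),
  [/\ S \in unitmx, T \in unitmx,
      S *m E *m T =
        castmx (hn, hn) (\mxdiag_(i < size bs) kblock_E (kblock_nth bs i))
    & S *m A *m T =
        castmx (hn, hn) (\mxdiag_(i < size bs) kblock_A (kblock_nth bs i))].

Definition pencil_index n (E A : 'M[C]_n) (nu : nat) : Prop :=
  exists2 bs, kronecker_form E A bs &
    nu = (\max_(b <- bs | b.1 == None) b.2)%N.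

Definition nonzero_blocks (bs : seq kblock) : seq kblock :=
  [seq b <- bs | b.1 != Some 0].

Definition same_nonzero_structure n (E A E' A' : 'M[C]_n) : Prop :=
  exists bs bs', [/\ kronecker_form E A bs, kronecker_form E' A' bs'
    & perm_eq (nonzero_blocks bs) (nonzero_blocks bs')].

Definition zero_semisimple n (E A : 'M[C]_n) : Prop :=
  exists2 bs, kronecker_form E A bs &
    all (fun b => (b.1 == Some 0) ==> (b.2 == 1%N)) bs.

End Matrices.

Section Blocks.
Context {T : Type} {n1 n2 n3 n4 : nat}.

Definition row3 m (A1 : 'M[T]_(m, n1)) (A2 : 'M[T]_(m, n2))
    (A4 : 'M[T]_(m, n4)) : 'M[T]_(m, n1 + (n2 + n4)) :=
  row_mx A1 (row_mx A2 A4).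

Definition row4 m (A1 : 'M[T]_(m, n1)) (A2 : 'M[T]_(m, n2))
    (A3 : 'M[T]_(m, n3)) (A4 : 'M[T]_(m, n4)) :
    'M[T]_(m, n1 + (n2 + (n3 + n4))) :=
  row_mx A1 (row_mx A2 (row_mx A3 A4)).

Definition col3 m (A1 : 'M[T]_(n1, m)) (A2 : 'M[T]_(n2, m))
    (A4 : 'M[T]_(n4, m)) : 'M[T]_(n1 + (n2 + n4), m) :=
  col_mx A1 (col_mx A2 A4).

Definition col4 m (A1 : 'M[T]_(n1, m)) (A2 : 'M[T]_(n2, m))
    (A3 : 'M[T]_(n3, m)) (A4 : 'M[T]_(n4, m)) :
    'M[T]_(n1 + (n2 + (n3 + n4)), m) :=
  col_mx A1 (col_mx A2 (col_mx A3 A4)).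

End Blocks.

(* Main.v *)
Require Import Defs.
From mathcomp Require Import zify ring lra.

Set Implicit Arguments.
Unset Strict Implicit.
Unset Printing Implicit Defensive.

(** In the coordinates of the condensed form the third block row of Q is zero.
Hence a Hermitian or skew-Hermitian perturbation of L whose blocks outside the
third block row and the third block column vanish changes L Q only in its third
block row: its third block column is multiplied by that zero row.  The pencil,
in turn, is strictly equivalent to the direct sum of the pencils
z I - E11^-1 A11, z I - Z and the n4 by n4 pencil with E = 0 and A = I, where
the only nonzero block of Z is A32 (condensed_equiv).  Since E11^-1 A11 is
invertible and Z is nilpotent, the structure for the nonzero eigenvalues is
independent of the third block row of A, and zero is semisimple as soon as
A32 = 0 (condensed_kronecker).  Both facts use the existence of the Jordan form
(jordan_form), which is proved by splitting off one Jordan block at a time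
(jordan_split).

So one has to make A32 = L3 Q2 vanish.  The dissipative part is prescribed to
contribute Yhat to the third block row: Delta_R has third block row - Yhat, up
to its diagonal block.  Taking Y^* = R0 M, the matrix R + Delta_R can be chosen
as T^* R T with T the block elimination matrix defined by M, which keeps it
positive semidefinite (completion_identity).  The size of its diagonal block is
governed by M^* R0 M and, through the Cauchy-Schwarz inequality of the form R,
by R33 (psd_completion).  The skew-Hermitian part then gets the third block row
- (L3 + Yhat) P, P being the orthogonal projection onto im Q2; it leaves
L3 Q2 + Yhat Q2 - (L3 + Yhat) P Q2 = 0.  Its Frobenius norm is sqrt 2 times that
of this row (frobenius_skew).

The matrices M and P are real when the data are, because they are determined by
properties which their conjugates share. *)

(** * Matrices in four by four blocks *)

Section FourBlocks.
Context {F : comNzRingType}.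

Lemma mul_row4 (n1 n2 n3 n4 m p : nat) (B1 : 'M[F]_(n1, m))
  (B2 : 'M[F]_(n2, m)) (B3 : 'M[F]_(n3, m)) (B4 : 'M[F]_(n4, m))
  (A1 : 'M[F]_(p, n1)) (A2 : 'M_(p, n2)) (A3 : 'M_(p, n3)) (A4 : 'M_(p, n4)) :
  row4 A1 A2 A3 A4 *m col4 B1 B2 B3 B4 =
  A1 *m B1 + (A2 *m B2 + (A3 *m B3 + A4 *m B4)).
Proof. by rewrite /row4 /col4 !mul_row_col. Qed.

Lemma mul_col4 (n1 n2 n3 n4 m p : nat) (B1 : 'M[F]_(n1, m))
  (B2 : 'M[F]_(n2, m)) (B3 : 'M[F]_(n3, m)) (B4 : 'M[F]_(n4, m))
  (A : 'M[F]_(m, p)) :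
  col4 B1 B2 B3 B4 *m A = col4 (B1 *m A) (B2 *m A) (B3 *m A) (B4 *m A).
Proof. by rewrite /col4 !mul_col_mx. Qed.

Lemma mul_mx_row4 (n1 n2 n3 n4 m p : nat) (B : 'M[F]_(m, p))
  (A1 : 'M[F]_(p, n1)) (A2 : 'M_(p, n2)) (A3 : 'M_(p, n3)) (A4 : 'M_(p, n4)) :
  B *m row4 A1 A2 A3 A4 = row4 (B *m A1) (B *m A2) (B *m A3) (B *m A4).
Proof. by rewrite /row4 !mul_mx_row. Qed.

Lemma add_row4 (n1 n2 n3 n4 p : nat)
  (A1 : 'M[F]_(p, n1)) (A2 : 'M_(p, n2)) (A3 : 'M_(p, n3)) (A4 : 'M_(p, n4))
  (B1 : 'M[F]_(p, n1)) (B2 : 'M_(p, n2)) (B3 : 'M_(p, n3)) (B4 : 'M_(p, n4)) :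
  row4 A1 A2 A3 A4 + row4 B1 B2 B3 B4 =
  row4 (A1 + B1) (A2 + B2) (A3 + B3) (A4 + B4).
Proof. by rewrite /row4 !add_row_mx. Qed.

Definition mul4E := (mul_col4, mul_row4, mul_mx_row4, add_row4, mul0mx, mulmx0,
  mul1mx, mulmx1, addr0, add0r).

Lemma col_mx_row0 (m1 m2 p q : nat) (b : 'M[F]_(m1, q)) (c : 'M_(m2, q)) :
  col_mx (row_mx (0 : 'M_(m1, p)) b) (row_mx 0 c) = row_mx 0 (col_mx b c).
Proof. by rewrite -[LHS]/(block_mx 0 b 0 c) block_mxEh col_mx0. Qed.

Lemma col_mx_row00 (m1 m2 p q : nat) (b : 'M[F]_(m1, q)) :
  col_mx (row_mx (0 : 'M_(m1, p)) b) 0 = row_mx 0 (col_mx b (0 : 'M_(m2, q))).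
Proof. by rewrite -col_mx_row0 row_mx0. Qed.

Lemma col_mx_0row (m1 m2 p q : nat) (c : 'M[F]_(m2, q)) :
  col_mx 0 (row_mx (0 : 'M_(m2, p)) c) = row_mx 0 (col_mx (0 : 'M_(m1, q)) c).
Proof. by rewrite -col_mx_row0 row_mx0. Qed.

Definition col_mx_rowE := (col_mx_row0, col_mx_row00, col_mx_0row).

Lemma col4_1 (n1 n2 n3 n4 : nat) :
  col4 (row4 1%:M 0 0 0) (row4 0 1%:M 0 0) (row4 0 0 1%:M 0) (row4 0 0 0 1%:M)
  = 1%:M :> 'M[F]_(n1 + (n2 + (n3 + n4))).
Proof.
by rewrite /col4 /row4 (scalar_mx_block n1) (scalar_mx_block n2)
  (scalar_mx_block n3) /block_mx !row_mx0 !col_mx_row0.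
Qed.

End FourBlocks.

(** * Existence of the Jordan form *)

Section JordanBlock.
Context {F : fieldType}.

(** Let the minimal polynomial of A be q (X - a)^(k+1) with q(a) != 0.  It does
not divide q^2 (X - a)^k, so some entry of q(A) N^k q(A) is nonzero; taking the
row of the left factor q(A) and the column of the right one that meet in this
entry gives u and w, on both of which N^(k+1) vanishes. *)
Lemma minpoly_witness n (A : 'M[F]_n.+1) (a : F) : eigenvalue A a ->
  exists (k : nat) (u : 'rV_n.+1) (w : 'cV_n.+1),
  let N := A - a%:M in
  [/\ u *m N ^+ k.+1 = 0, N ^+ k.+1 *m w = 0
    & u *m N ^+ k *m w != 0].
Proof.
rewrite eigenvalue_root_min => rp; have p0 := monic_neq0 (mxminpoly_monic A).
have [m [q]] := multiplicity_XsubC (mxminpoly A) a.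
rewrite p0 /= => rq pE; case: m pE => [|k] pE.
  by move: rp; rewrite pE expr0 mulr1 (negPf rq).
pose N := A - a%:M.
have NE : horner_mx A ('X - a%:P) = N.
  by rewrite rmorphB /= horner_mx_X horner_mx_C.
have [i [j Mij]] : exists i j,
    (horner_mx A q *m N ^+ k *m horner_mx A q) i j != 0.
  apply/matrix0Pn; rewrite -NE -rmorphXn /= !mulmxE -!rmorphM /=.
  apply: contra rq => /eqP /mxminpoly_min; rewrite pE -mulrA.
  have q0 : q != 0 by apply: contra_neq p0 => q0; rewrite pE q0 mul0r.
  rewrite dvdp_mul2l // mulrC exprS dvdp_mul2r ?dvdp_XsubCl //.
  by rewrite expf_neq0 // polyXsubC_eq0.
exists k, (row i (horner_mx A q)), (col j (horner_mx A q)).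
rewrite /= -/N; split.
- rewrite -row_mul -NE -rmorphXn /= mulmxE -rmorphM /= -pE.
  by rewrite mx_root_minpoly row0.
- rewrite colE mulmxA -NE -rmorphXn /= mulmxE -rmorphM /= mulrC -pE.
  by rewrite mx_root_minpoly mul0mx.
- apply: contra Mij => /eqP uNw; apply/eqP.
  have := congr1 (fun x : 'M_1 => x 0 0) uNw.
  rewrite -row_mul colE mulmxA -colE [RHS]mxE => <-.
  by rewrite -row_mul [RHS]mxE [RHS]mxE.
Qed.

(** The matrix jordan_block over an arbitrary field; over K[i] the two are
convertible. *)
Definition jordan_mx k (a : F) : 'M[F]_k :=
  \matrix_(i, j) (a *+ (i == j) + (i.+1 == j :> nat)%:R).

Lemma jordan_mx_mul k n a (P : 'M[F]_(k, n)) s :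
  row s (jordan_mx k a *m P) =
  a *: row s P + oapp (fun t => row t P) 0 (insub s.+1).
Proof.
rewrite row_mul mulmx_sum_row (bigD1 s) //= !mxE eqxx mulr1n.
rewrite -[(s.+1 == s)]/(s.+1 == s :> nat) gtn_eqF // addr0; congr (_ + _).
case: insubP => [t _ tE|sk] /=; last first.
  rewrite big1 // => t ts; rewrite !mxE eq_sym (negPf ts) mulr0n add0r.
  by rewrite (_ : (_ == _) = false) ?scale0r //; apply: contraNF sk => /eqP->.
rewrite (bigD1 t) /=; last by rewrite -val_eqE /= tE gtn_eqF.
rewrite !mxE -val_eqE /= tE ltn_eqF // mulr0n add0r eqxx scale1r.
rewrite big1 ?addr0 // => x /andP[xs xt].
rewrite !mxE eq_sym (negPf xs) mulr0n add0r.
by rewrite -tE eq_sym val_eqE (negPf xt) scale0r.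
Qed.

(** The rows u, u N, ..., u N^k span an A-invariant space on which A acts as a
Jordan block.  An invariant complement is the space of the rows annihilating
N^k w, ..., N w, w: the pairing of the two chains is triangular, with the
nonzero number u N^k w on its diagonal. *)
Lemma jordan_split n (A : 'M[F]_n.+1) (a : F) : eigenvalue A a ->
  exists (k r : nat) (A' : 'M[F]_r) (T : 'M_(k.+1 + r, n.+1))
         (T' : 'M_(n.+1, k.+1 + r)),
  [/\ {subset eigenvalue A' <= eigenvalue A}, T *m T' = 1%:M, T' *m T = 1%:M
    & T *m A = block_mx (jordan_mx k.+1 a) 0 0 A' *m T].
Proof.
move=> /minpoly_witness[k [u [w]]]; set N := A - a%:M => /= -[uN Nw uNw].
have uN0 m : (k < m)%N -> u *m N ^+ m = 0.
  by move=> km; rewrite -(subnKC km) exprD -mulmxE mulmxA uN mul0mx.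
(* The column chain is listed backwards to make P *m V triangular. *)
pose P : 'M_(k.+1, n.+1) := \matrix_(s, j) (u *m N ^+ s) 0 j.
pose V : 'M_(n.+1, k.+1) := \matrix_(i, t) (N ^+ (k - t) *m w) i 0.
have rP s : row s P = u *m N ^+ s.
  by apply/rowP => j; rewrite !mxE.
have cV t : col t V = N ^+ (k - t) *m w.
  by apply/colP => j; rewrite !mxE.
have PV s t : (P *m V) s t = (u *m N ^+ (s + (k - t)) *m w) 0 0.
  rewrite exprD -mulmxE (mulmxA u) -mulmxA -cV -rP [RHS]mxE.
  by rewrite [LHS]mxE; apply: eq_bigr => j _; rewrite !mxE.
have uG : P *m V \in unitmx.
  rewrite unitmxE -det_tr det_trig; last first.
    apply/is_trig_mxP => i j ij; rewrite mxE PV uN0 ?mul0mx ?mxE //.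
    by have := ltn_ord i; lia.
  rewrite unitfE; apply/prodf_neq0 => i _; rewrite mxE PV.
  rewrite subnKC; last by rewrite -ltnS.
  by apply: contra uNw => /eqP u0; apply/eqP/rowP => j; rewrite !ord1 u0 mxE.
pose B := row_base (kermx V); set r := \rank _ in B.
have BV : B *m V = 0 by apply/sub_kermxP; rewrite eq_row_base.
have Bfree : row_free B by apply: row_base_free.
have NV x : x *m V = 0 -> x *m N *m V = 0.
  move=> xV; apply/matrixP => i t.
  suff /colP/(_ i) : col t (x *m N *m V) = 0 by rewrite mxE => ->; rewrite !mxE.
  rewrite colE -mulmxA -colE cV -mulmxA (mulmxA N) mulmxE -exprS.
  case: t => [[|t] tk] /=; first by rewrite subn0 Nw mulmx0.
  have -> : (k - t.+1).+1 = (k - Ordinal (ltnW tk))%N by rewrite /=; lia.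
  by rewrite -cV colE mulmxA xV mul0mx.
have AV x : x *m V = 0 -> x *m A *m V = 0.
  move=> xV; rewrite -[A](subrK a%:M) mulmxDr mulmxDl NV // add0r.
  by rewrite -mulmxA mul_scalar_mx -scalemxAr xV scaler0.
have subB m (x : 'M_(m, n.+1)) : x *m V = 0 -> x *m pinvmx B *m B = x.
  by move=> xV; apply: mulmxKpV; rewrite eq_row_base; apply/sub_kermxP.
(* Pi projects onto the row space of P along that of B. *)
pose G' := invmx (P *m V); pose Pi := V *m G' *m P.
have PiV : (1%:M - Pi) *m V = 0.
  by rewrite mulmxBl mul1mx /Pi -!mulmxA mulVmx // mulmx1 subrr.
have PPi : P *m (1%:M - Pi) = 0.
  by rewrite mulmxBr mulmx1 /Pi !mulmxA mulmxV // mul1mx subrr.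
have BPi : B *m (1%:M - Pi) = B.
  by rewrite mulmxBr mulmx1 /Pi !mulmxA BV !mul0mx subr0.
pose X := (1%:M - Pi) *m pinvmx B.
have XB : X *m B = 1%:M - Pi by rewrite /X subB.
have PX : P *m X = 0.
  by apply: (row_free_inj Bfree); rewrite /= -mulmxA XB PPi mul0mx.
have BX : B *m X = 1%:M.
  by apply: (row_free_inj Bfree); rewrite /= -mulmxA XB BPi mul1mx.
have A'B : B *m A *m pinvmx B *m B = B *m A by rewrite subB // AV.
exists k, r, (B *m A *m pinvmx B), (col_mx P B), (row_mx (V *m G') X); split.
- move=> c /eigenvalueP[v vA v0]; apply/eigenvalueP; exists (v *m B).
    by rewrite -mulmxA -A'B mulmxA vA scalemxAl.
  by apply: contra_neq v0 => vB; apply: (row_free_inj Bfree); rewrite mul0mx.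
- rewrite mul_col_row PX BX !mulmxA BV mul0mx mulmxV //.
  by rewrite -scalar_mx_block.
- by rewrite mul_row_col XB addrC subrK.
- rewrite mul_block_col mul_col_mx !mul0mx addr0 add0r A'B; congr col_mx.
  apply/row_matrixP => s; rewrite jordan_mx_mul row_mul rP.
  rewrite -[A](subrK a%:M) -/N mulmxDr mul_mx_scalar addrC.
  rewrite -mulmxA mulmxE -exprSr; congr (_ + _).
  case: insubP => [t _ tE|sk] /=; first by rewrite rP tE.
  by rewrite uN0 //; lia.
Qed.
End JordanBlock.

(** * Strict equivalence and Kronecker forms *)

Section Pencils.
Context {K : realType}.
Local Notation C := K[i].

(** Invertibility of a matrix whose two sizes are equal only provably: the size
of a block diagonal Kronecker form is a sum over its blocks, and rectangular
inverses spare all the casts between this sum and n. *)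
Definition mx_iso m n (S : 'M[C]_(m, n)) : Prop :=
  exists S' : 'M[C]_(n, m), S *m S' = 1%:M /\ S' *m S = 1%:M.

Lemma unitmx_iso n (S : 'M[C]_n) : S \in unitmx -> mx_iso S.
Proof. by move=> uS; exists (invmx S); rewrite mulmxV // mulVmx. Qed.

Lemma mx_isoM m n p (S : 'M[C]_(m, n)) (T : 'M[C]_(n, p)) :
  mx_iso S -> mx_iso T -> mx_iso (S *m T).
Proof.
move=> [S' [SS' S'S]] [T' [TT' T'T]]; exists (T' *m S'); split.
  by rewrite mulmxA -(mulmxA S) TT' mulmx1.
by rewrite mulmxA -(mulmxA T') S'S mulmx1.
Qed.

Lemma mx_iso_size m n (S : 'M[C]_(m, n)) : mx_iso S -> m = n.
Proof.
move=> [S' [SS' S'S]]; apply/eqP.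
by rewrite eqn_leq (mulmx1_min SS') (mulmx1_min S'S).
Qed.

Lemma mx_iso_unit n (S : 'M[C]_n) : mx_iso S -> S \in unitmx.
Proof. by move=> [S' [/mulmx1_unit[]]]. Qed.

Lemma mx_iso_diag m n p q (S : 'M[C]_(m, n)) (T : 'M[C]_(p, q)) :
  mx_iso S -> mx_iso T -> mx_iso (block_mx S 0 0 T).
Proof.
move=> [S' [SS' S'S]] [T' [TT' T'T]]; exists (block_mx S' 0 0 T').
by rewrite !mulmx_block !(mul0mx, mulmx0, addr0, add0r) SS' S'S TT' T'T
  -!scalar_mx_block.
Qed.

(** Strict equivalence of the pencils z E - A and z E' - A'. *)
Definition pencil_equiv m n (E A : 'M[C]_m) (E' A' : 'M[C]_n) : Prop :=
  exists (S : 'M[C]_(n, m)) (T : 'M[C]_(m, n)),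
  [/\ mx_iso S, mx_iso T, S *m E *m T = E' & S *m A *m T = A'].

Lemma pencil_equiv_refl n (E A : 'M[C]_n) : pencil_equiv E A E A.
Proof.
exists 1%:M, 1%:M; rewrite !mul1mx !mulmx1.
by split=> //; apply/unitmx_iso/unitmx1.
Qed.

Lemma pencil_equiv_trans m n p (E A : 'M[C]_m) (E' A' : 'M[C]_n)
    (E'' A'' : 'M[C]_p) :
  pencil_equiv E A E' A' -> pencil_equiv E' A' E'' A'' ->
  pencil_equiv E A E'' A''.
Proof.
move=> [S [T [iS iT <- <-]]] [S' [T' [iS' iT' <- <-]]].
exists (S' *m S), (T *m T'); rewrite !mulmxA; split=> //; exact: mx_isoM.
Qed.

Lemma pencil_equiv_sym m n (E A : 'M[C]_m) (E' A' : 'M[C]_n) :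
  pencil_equiv E A E' A' -> pencil_equiv E' A' E A.
Proof.
move=> [S [T [[S' [SS' S'S]] [T' [TT' T'T]] <- <-]]].
exists S', T'; split; [by exists S | by exists T | |];
  by rewrite -!mulmxA TT' mulmx1 mulmxA S'S mul1mx.
Qed.

Lemma pencil_equiv_diag m n p q (E1 A1 : 'M[C]_m) (E1' A1' : 'M[C]_n)
    (E2 A2 : 'M[C]_p) (E2' A2' : 'M[C]_q) :
  pencil_equiv E1 A1 E1' A1' -> pencil_equiv E2 A2 E2' A2' ->
  pencil_equiv (block_mx E1 0 0 E2) (block_mx A1 0 0 A2)
               (block_mx E1' 0 0 E2') (block_mx A1' 0 0 A2').
Proof.
move=> [S [T [iS iT <- <-]]] [S' [T' [iS' iT' <- <-]]].
exists (block_mx S 0 0 S'), (block_mx T 0 0 T').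
rewrite !mulmx_block !(mul0mx, mulmx0, addr0, add0r).
by split=> //; apply: mx_iso_diag.
Qed.

Lemma pencil_equiv_cast m n (e e' : m = n) (E A : 'M[C]_m) :
  pencil_equiv E A (castmx (e, e') E) (castmx (e, e') A).
Proof.
case: _ / e e' => e'; rewrite (eq_irrelevance e' erefl) !castmx_id.
exact: pencil_equiv_refl.
Qed.

Lemma pencil_equiv0 (E A : 'M[C]_0) m (E' A' : 'M[C]_m) : m = 0%N ->
  pencil_equiv E A E' A'.
Proof.
move=> m0; subst m; rewrite [E']flatmx0 [A']flatmx0 [E]flatmx0 [A]flatmx0.
exact: pencil_equiv_refl.
Qed.

Lemma pencil_equiv_regular m n (E A : 'M[C]_m) (E' A' : 'M[C]_n) :
  pencil_equiv E A E' A' -> regular_pencil E' A' -> regular_pencil E A.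
Proof.
move=> [S [T [iS iT <- <-]]]; have e := mx_iso_size iS; subst m.
rewrite /regular_pencil => h; apply: contra_neq h => d0.
have -> : 'X *: map_mx polyC (S *m E *m T) - map_mx polyC (S *m A *m T)
  = map_mx polyC S *m ('X *: map_mx polyC E - map_mx polyC A)
    *m map_mx polyC T.
  by rewrite !map_mxM /= mulmxBr mulmxBl -scalemxAr -scalemxAl.
by rewrite !det_mulmx d0 mulr0 mul0r.
Qed.

Lemma regular_pencil_diag m n (E1 A1 : 'M[C]_m) (E2 A2 : 'M[C]_n) :
  regular_pencil E1 A1 -> regular_pencil E2 A2 ->
  regular_pencil (block_mx E1 0 0 E2) (block_mx A1 0 0 A2).
Proof.
rewrite /regular_pencil => h1 h2.
rewrite !map_block_mx !map_mx0 scale_block_mx !scaler0 opp_block_mx !oppr0.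
by rewrite add_block_mx !addr0 det_ublock mulf_neq0.
Qed.

Lemma regular_pencil_1A n (A : 'M[C]_n) : regular_pencil 1%:M A.
Proof.
rewrite /regular_pencil map_scalar_mx /= scale_scalar_mx polyC1 mulr1.
by rewrite -/(char_poly_mx A) monic_neq0 // char_poly_monic.
Qed.

Lemma regular_pencil_01 n : regular_pencil (0 : 'M[C]_n) 1%:M.
Proof.
rewrite /regular_pencil map_mx0 scaler0 sub0r map_scalar_mx /= polyC1.
by rewrite -scalemx1 scale1r -scaleN1r detZ det1 mulr1 signr_eq0.
Qed.

Definition kdim (bs : seq (kblock (K := K))) : nat :=
  (\sum_(i < size bs) (kblock_nth bs i).2)%N.

Definition kmxE (bs : seq (kblock (K := K))) : 'M[C]_(kdim bs) :=
  \mxdiag_(i < size bs) kblock_E (kblock_nth bs i).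

Definition kmxA (bs : seq (kblock (K := K))) : 'M[C]_(kdim bs) :=
  \mxdiag_(i < size bs) kblock_A (kblock_nth bs i).

Lemma kronecker_formP n (E A : 'M[C]_n) bs :
  all (fun b => 0 < b.2)%N bs -> pencil_equiv E A (kmxE bs) (kmxA bs) ->
  kronecker_form E A bs.
Proof.
move=> bs0 h; split=> //.
have [S [T [iS _ _ _]]] := h.
exists (mx_iso_size iS).
have /(pencil_equiv_trans h) :=
  pencil_equiv_cast (mx_iso_size iS) (mx_iso_size iS) (kmxE bs) (kmxA bs).
move=> [S' [T' [iS' iT' eE eA]]].
by exists S', T'; split=> //; apply: mx_iso_unit.
Qed.

Lemma kronecker_form_equiv n (E A : 'M[C]_n) bs :
  kronecker_form E A bs -> pencil_equiv E A (kmxE bs) (kmxA bs).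
Proof.
case=> _ [hn]; case: _ / hn E A => E A [S [T [uS uT]]].
rewrite !castmx_id => eE eA.
by exists S, T; split=> //; apply: unitmx_iso.
Qed.

Lemma kmx_cons b bs :
  pencil_equiv (block_mx (kblock_E b) 0 0 (kmxE bs))
               (block_mx (kblock_A b) 0 0 (kmxA bs))
               (kmxE (b :: bs)) (kmxA (b :: bs)).
Proof.
rewrite /kmxE /kmxA !mxdiag_recl; exact: pencil_equiv_cast.
Qed.

Lemma kmx_nil m (E A : 'M[C]_m) : m = 0%N ->
  pencil_equiv E A (kmxE [::]) (kmxA [::]).
Proof.
move=> m0; subst m; apply: pencil_equiv0; rewrite /kdim big_ord0 //.
Qed.

Lemma block_diagA m1 m2 m3 (A1 : 'M[C]_m1) (A2 : 'M[C]_m2) (A3 : 'M[C]_m3) :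
  block_mx A1 0 0 (block_mx A2 0 0 A3) =
  castmx (esym (addnA m1 m2 m3), esym (addnA m1 m2 m3))
    (block_mx (block_mx A1 0 0 A2) 0 0 A3).
Proof.
by have := @block_mxA _ m1 m2 m3 m1 m2 m3 A1 0 0 0 A2 0 0 0 A3;
  rewrite /= row_mx0 !col_mx0 row_mx0.
Qed.

Lemma pencil_equiv_diagA m1 m2 m3 (E1 A1 : 'M[C]_m1) (E2 A2 : 'M[C]_m2)
    (E3 A3 : 'M[C]_m3) :
  pencil_equiv (block_mx (block_mx E1 0 0 E2) 0 0 E3)
               (block_mx (block_mx A1 0 0 A2) 0 0 A3)
               (block_mx E1 0 0 (block_mx E2 0 0 E3))
               (block_mx A1 0 0 (block_mx A2 0 0 A3)).
Proof. rewrite !block_diagA; exact: pencil_equiv_cast. Qed.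

Lemma pencil_equiv_0diag m n (E0 A0 : 'M[C]_m) (E A : 'M[C]_n) : m = 0%N ->
  pencil_equiv (block_mx E0 0 0 E) (block_mx A0 0 0 A) E A.
Proof.
move=> m0; subst m.
have i01 : mx_iso (row_mx 0 1%:M : 'M[C]_(n, 0 + n)).
  exists (col_mx 0 1%:M); split.
    by rewrite mul_row_col mul0mx mul1mx add0r.
  rewrite mul_col_row !mulmx0 !mulmx1 [RHS](scalar_mx_block 0 n).
  by congr block_mx; rewrite (flatmx0 1%:M).
have j01 : mx_iso (col_mx 0 1%:M : 'M[C]_(0 + n, n)).
  exists (row_mx 0 1%:M); split.
    rewrite mul_col_row !mulmx0 !mulmx1 [RHS](scalar_mx_block 0 n).
    by congr block_mx; rewrite (flatmx0 1%:M).
  by rewrite mul_row_col mul0mx mul1mx add0r.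
exists (row_mx 0 1%:M), (col_mx 0 1%:M); split=> //;
  by rewrite mul_row_block mul_row_col !(mulmx0, mul0mx, mul1mx, mulmx1, add0r).
Qed.

Lemma kmx_cat bs1 bs2 :
  pencil_equiv (block_mx (kmxE bs1) 0 0 (kmxE bs2))
               (block_mx (kmxA bs1) 0 0 (kmxA bs2))
               (kmxE (bs1 ++ bs2)) (kmxA (bs1 ++ bs2)).
Proof.
elim: bs1 => [|b bs1 IH] /=.
  by apply: pencil_equiv_0diag; rewrite /kdim big_ord0.
apply: pencil_equiv_trans (kmx_cons _ _).
apply: pencil_equiv_trans; last first.
  exact: pencil_equiv_diag (pencil_equiv_refl _ _) IH.
apply: pencil_equiv_trans (pencil_equiv_diagA _ _ _ _ _ _).
apply: pencil_equiv_diag (pencil_equiv_refl _ _).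
exact/pencil_equiv_sym/kmx_cons.
Qed.

Lemma kronecker_form_diag m n (E1 A1 : 'M[C]_m) (E2 A2 : 'M[C]_n) bs1 bs2 :
  kronecker_form E1 A1 bs1 -> kronecker_form E2 A2 bs2 ->
  kronecker_form (block_mx E1 0 0 E2) (block_mx A1 0 0 A2) (bs1 ++ bs2).
Proof.
move=> h1 h2; apply: kronecker_formP.
  by rewrite all_cat h1.1 h2.1.
apply: pencil_equiv_trans (kmx_cat _ _).
by apply: pencil_equiv_diag; apply: kronecker_form_equiv.
Qed.

Lemma kronecker_form_pencil_equiv m n (E A : 'M[C]_m) (E' A' : 'M[C]_n) bs :
  pencil_equiv E A E' A' -> kronecker_form E' A' bs -> kronecker_form E A bs.
Proof.
move=> h k; apply: kronecker_formP k.1 _.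
exact: pencil_equiv_trans h (kronecker_form_equiv k).
Qed.

Lemma kronecker_form_nseq n (o : option C) (e a : C) :
  kblock_E (o, 1%N) = e%:M -> kblock_A (o, 1%N) = a%:M ->
  kronecker_form (e%:M : 'M[C]_n) a%:M (nseq n (o, 1%N)).
Proof.
move=> hE hA; elim: n => [|n IH].
  by apply: kronecker_formP => //; apply: kmx_nil.
apply: kronecker_formP; first by rewrite all_nseq orbT.
apply: pencil_equiv_trans (kmx_cons _ _).
rewrite hE hA !(scalar_mx_block 1 n).
apply: pencil_equiv_diag (pencil_equiv_refl _ _) _.
exact: kronecker_form_equiv.
Qed.

Lemma kronecker_form_cons m n p (E : 'M[C]_m) (A : 'M[C]_m) o
    (E2 A2 : 'M[C]_n) bs : (0 < p)%N ->
  pencil_equiv E A (block_mx (kblock_E (o, p)) 0 0 E2)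
                   (block_mx (kblock_A (o, p)) 0 0 A2) ->
  kronecker_form E2 A2 bs -> kronecker_form E A ((o, p) :: bs).
Proof.
move=> p0 h k; apply: kronecker_formP; first by rewrite /= p0 k.1.
apply: pencil_equiv_trans (kmx_cons _ _).
apply: pencil_equiv_trans h _.
apply: pencil_equiv_diag (pencil_equiv_refl _ _) _.
exact: kronecker_form_equiv.
Qed.

(** The Jordan canonical form, obtained by splitting off one block at a time. *)
Lemma jordan_form n (A : 'M[C]_n) :
  exists2 bs, kronecker_form 1%:M A bs &
    {in bs, forall b, exists2 a, b.1 = Some a & eigenvalue A a}.
Proof.
have [N] := ubnP n; elim: N n A => // N IH [|n] A nN.
  by exists [::] => //; apply: kronecker_formP => //; apply: kmx_nil.
have [a ea] := eigenvalue_closed A (ltn0Sn n).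
have [k [r [A' [T [T' [sA' TT' T'T TA]]]]]] := jordan_split ea.
have iT : mx_iso T by exists T'.
have iT' : mx_iso T' by exists T.
have rn : (r < N)%N by have := mx_iso_size iT; lia.
have [bs kbs ebs] := IH r A' rn.
exists ((Some a, k.+1) :: bs).
  apply: (kronecker_form_cons (ltn0Sn k) _ kbs); exists T, T'; split=> //.
    by rewrite mulmx1 TT' [LHS]scalar_mx_block.
  by rewrite TA -mulmxA TT' mulmx1.
move=> b; rewrite inE => /predU1P[->|/ebs[c bc ec]].
  by exists a; [reflexivity | exact: ea].
by exists c; [exact: bc | exact: (sA' c ec)].
Qed.

End Pencils.

(** * Pencils in condensed form *)

Section Condensed.
Context {F : fieldType}.
Variables n1 n2 n3 n4 : nat.
Local Notation n := (n1 + (n2 + (n3 + n4)))%N.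

(** Row operations with the invertible block A44 remove the last block column
and normalize A44 to the identity, a further one turns the finite part of E into
the identity.  The finite part of A then is block lower triangular with
diagonal blocks C = E11^-1 A11 and a matrix Z whose only nonzero block is A32.
As C is invertible and Z nilpotent, the Sylvester equation W C - Z W = G has a
solution, and the corresponding similarity removes the block G below C. *)
Lemma condensed_decouple (E11 : 'M[F]_n1) (E21 : 'M_(n2, n1)) (E22 : 'M_n2)
    (A11 : 'M_n1) A14 A21 A24 (A31 : 'M_(n3, n1)) A32 A34 (A44 : 'M_n4) :
  E11 \in unitmx -> E22 \in unitmx -> A11 \in unitmx -> A44 \in unitmx ->
  exists S T : 'M[F]_n,
  [/\ S \in unitmx, T \in unitmx,
     S *m col4 (row4 E11 0 0 0) (row4 E21 E22 0 0) (row4 0 0 1%:M 0)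
            (row4 0 0 0 0) *m T
     = col4 (row4 1%:M 0 0 0) (row4 0 1%:M 0 0) (row4 0 0 1%:M 0)
            (row4 0 0 0 0)
   & S *m col4 (row4 A11 0 0 A14) (row4 A21 0 0 A24) (row4 A31 A32 0 A34)
          (row4 0 0 0 A44) *m T
     = col4 (row4 (invmx E11 *m A11) 0 0 0) (row4 0 0 0 0) (row4 0 A32 0 0)
          (row4 0 0 0 1%:M)].
Proof.
move=> uE1 uE2 uA1 uA4; set C11 := invmx E11 *m A11.
pose F21 := invmx E22 *m (A21 - E21 *m C11).
(* (W2, W3) solves the Sylvester equation; two steps suffice as Z^2 = 0. *)
pose W2 := F21 *m invmx C11; pose W3 := (A31 + A32 *m W2) *m invmx C11.
have uC : C11 \in unitmx by rewrite unitmx_mul unitmx_inv uE1.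
pose S1 : 'M[F]_n :=
  col4 (row4 1%:M 0 0 (- A14 *m invmx A44))
       (row4 0 1%:M 0 (- A24 *m invmx A44))
       (row4 0 0 1%:M (- A34 *m invmx A44)) (row4 0 0 0 (invmx A44)).
have [uS1 _] : S1 \in unitmx /\ col4 (row4 1%:M 0 0 A14) (row4 0 1%:M 0 A24)
     (row4 0 0 1%:M A34) (row4 0 0 0 A44) \in unitmx.
  apply: mulmx1_unit; rewrite -[RHS]col4_1 /S1 !mul4E !mulmxKV // mulVmx //.
  by rewrite !subrr.
pose S2 : 'M[F]_n :=
  col4 (row4 (invmx E11) 0 0 0)
       (row4 (- invmx E22 *m E21 *m invmx E11) (invmx E22) 0 0)
       (row4 0 0 1%:M 0) (row4 0 0 0 1%:M).
have [uS2 _] : S2 \in unitmx /\ col4 (row4 E11 0 0 0) (row4 E21 E22 0 0)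
     (row4 0 0 1%:M 0) (row4 0 0 0 1%:M) \in @unitmx F n.
  apply: mulmx1_unit; rewrite -[RHS]col4_1 /S2 !mul4E !mulmxKV // !mulVmx //.
  by rewrite mulNmx addNr.
pose S3 (W2 : 'M[F]_(n2, n1)) (W3 : 'M[F]_(n3, n1)) : 'M[F]_n :=
  col4 (row4 1%:M 0 0 0) (row4 W2 1%:M 0 0) (row4 W3 0 1%:M 0)
       (row4 0 0 0 1%:M).
have [uS3 uS3'] : S3 W2 W3 \in unitmx /\ S3 (- W2) (- W3) \in unitmx.
  by apply: mulmx1_unit; rewrite -[RHS]col4_1 /S3 !mul4E !subrr.
exists (S3 (- W2) (- W3) *m (S2 *m S1)), (S3 W2 W3); split=> //.
- by rewrite !unitmx_mul uS1 uS2 uS3'.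
- rewrite -!mulmxA (mulmxA S1) [S1 *m _](_ : _ = col4 (row4 E11 0 0 0)
    (row4 E21 E22 0 0) (row4 0 0 1%:M 0) (row4 0 0 0 0)); last first.
    by rewrite /S1 !mul4E.
  rewrite (mulmxA S2) [S2 *m _](_ : _ = col4 (row4 1%:M 0 0 0)
    (row4 0 1%:M 0 0) (row4 0 0 1%:M 0) (row4 0 0 0 0)); last first.
    by rewrite /S2 !mul4E !mulVmx // mulmxKV // mulNmx addNr.
  by rewrite /S3 !mul4E !addNr.
- rewrite -!mulmxA (mulmxA S1) [S1 *m _](_ : _ = col4 (row4 A11 0 0 0)
    (row4 A21 0 0 0) (row4 A31 A32 0 0) (row4 0 0 0 1%:M)); last first.
    by rewrite /S1 !mul4E !mulmxKV // mulVmx // !subrr.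
  rewrite (mulmxA S2) [S2 *m _](_ : _ = col4 (row4 C11 0 0 0)
    (row4 F21 0 0 0) (row4 A31 A32 0 0) (row4 0 0 0 1%:M)); last first.
    by rewrite /S2 !mul4E /F21 mulmxBr !mulNmx addrC !mulmxA.
  by rewrite /S3 !mul4E !mulNmx /W2 /W3 !mulmxKV // !addNr.
Qed.
End Condensed.

Section CondensedPencil.
Context {K : realType}.
Local Notation C := K[i].
Variables n1 n2 n3 n4 : nat.
Local Notation n := (n1 + (n2 + (n3 + n4)))%N.

(** The three diagonal pencils carry the nonzero finite eigenvalues, the
eigenvalue zero and the eigenvalue infinity; of the third block row of A only
A32 remains, and only in the second one. *)
Lemma condensed_equiv (E11 : 'M[C]_n1) (E21 : 'M_(n2, n1)) (E22 : 'M_n2)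
    (A11 : 'M_n1) A14 A21 A24 (A31 : 'M_(n3, n1)) A32 A34 (A44 : 'M_n4) :
  E11 \in unitmx -> E22 \in unitmx -> A11 \in unitmx -> A44 \in unitmx ->
  pencil_equiv
    (col4 (row4 E11 0 0 0) (row4 E21 E22 0 0) (row4 0 0 1%:M 0)
          (row4 0 0 0 0))
    (col4 (row4 A11 0 0 A14) (row4 A21 0 0 A24) (row4 A31 A32 0 A34)
          (row4 0 0 0 A44))
    (block_mx (1%:M : 'M_n1) 0 0
       (block_mx (1%:M : 'M_(n2 + n3)) 0 0 (0 : 'M_n4)))
    (block_mx (invmx E11 *m A11) 0 0
       (block_mx (block_mx 0 0 A32 0 : 'M_(n2 + n3)) 0 0 1%:M)).
Proof.
move=> uE1 uE2 uA1 uA4.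
have [S [T [uS uT eE eA]]] :=
  condensed_decouple E21 A14 A21 A24 A31 A32 A34 uE1 uE2 uA1 uA4.
have e : pencil_equiv
    (col4 (row4 E11 0 0 0) (row4 E21 E22 0 0) (row4 0 0 1%:M 0)
          (row4 0 0 0 0))
    (col4 (row4 A11 0 0 A14) (row4 A21 0 0 A24) (row4 A31 A32 0 A34)
          (row4 0 0 0 A44))
    (col4 (row4 1%:M 0 0 0) (row4 0 1%:M 0 0) (row4 0 0 1%:M 0)
            (row4 0 0 0 0))
    (col4 (row4 (invmx E11 *m A11) 0 0 0) (row4 0 0 0 0) (row4 0 A32 0 0)
          (row4 0 0 0 1%:M) : 'M[C]_n).
  by exists S, T; split; [exact: unitmx_iso | exact: unitmx_iso | |].
apply: pencil_equiv_trans e _.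
have -> : col4 (row4 1%:M 0 0 0) (row4 0 1%:M 0 0) (row4 0 0 1%:M 0)
            (row4 0 0 0 0) =
  block_mx (1%:M : 'M[C]_n1) 0 0 (block_mx (1%:M : 'M_n2) 0 0
     (block_mx (1%:M : 'M_n3) 0 0 (0 : 'M_n4))).
  by rewrite /col4 /row4 /block_mx !(row_mx0, col_mx_rowE).
have -> : col4 (row4 (invmx E11 *m A11) 0 0 0) (row4 0 0 0 0)
     (row4 0 A32 0 0) (row4 0 0 0 1%:M) =
  block_mx (invmx E11 *m A11) 0 0 (block_mx (0 : 'M_n2) 0 (col_mx A32 0)
     (block_mx (0 : 'M_n3) 0 0 (1%:M : 'M_n4))).
  rewrite /col4 /row4 /block_mx !(row_mx0, col_mx_rowE).
  congr (col_mx _ (row_mx 0 (col_mx 0 _))).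
  by rewrite -[LHS]/(block_mx A32 0 0 _) block_mxEh col_mx_0row.
apply: pencil_equiv_diag (pencil_equiv_refl _ _) _.
have := @block_mxA _ n2 n3 n4 n2 n3 n4 0 0 0 A32 0 0 0 0 1%:M.
rewrite /= row_mx0 !col_mx0 row_mx0 => ->.
rewrite block_diagA -scalar_mx_block.
exact/pencil_equiv_sym/pencil_equiv_cast.
Qed.
End CondensedPencil.

Section CondensedKronecker.
Context {K : realType}.
Local Notation C := K[i].
Variables n1 n2 n3 n4 : nat.
Local Notation n := (n1 + (n2 + (n3 + n4)))%N.

Lemma square_zero_eigenvalue m (Z : 'M[C]_m) a :
  Z *m Z = 0 -> eigenvalue Z a -> a = 0.
Proof.
move=> ZZ /eigenvalueP[v vZ v0]; apply: contra_neq_eq v0 => a0.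
have : v *m (Z *m Z) = (a * a) *: v.
  by rewrite mulmxA vZ -scalemxAl vZ scalerA.
rewrite ZZ mulmx0 => /esym/eqP; rewrite scaler_eq0 mulf_eq0 (negPf a0) /=.
by move/eqP.
Qed.

Lemma unit_eigenvalue m (A : 'M[C]_m) a :
  A \in unitmx -> eigenvalue A a -> a != 0.
Proof.
move=> uA /eigenvalueP[v vA v0]; apply: contra_neq v0 => a0.
by rewrite -[v](mulmxK uA) vA a0 scale0r mul0mx.
Qed.

Lemma condensed_regular (E11 : 'M[C]_n1) (E21 : 'M_(n2, n1)) (E22 : 'M_n2)
    (A11 : 'M_n1) A14 A21 A24 (A31 : 'M_(n3, n1)) A32 A34 (A44 : 'M_n4) :
  E11 \in unitmx -> E22 \in unitmx -> A11 \in unitmx -> A44 \in unitmx ->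
  regular_pencil
    (col4 (row4 E11 0 0 0) (row4 E21 E22 0 0) (row4 0 0 1%:M 0)
          (row4 0 0 0 0))
    (col4 (row4 A11 0 0 A14) (row4 A21 0 0 A24) (row4 A31 A32 0 A34)
          (row4 0 0 0 A44)).
Proof.
move=> uE1 uE2 uA1 uA4.
apply: (pencil_equiv_regular (condensed_equiv _ _ _ _ _ _ _ uE1 uE2 uA1 uA4)).
apply: regular_pencil_diag (regular_pencil_1A _) _.
exact: regular_pencil_diag (regular_pencil_1A _) (regular_pencil_01 _).
Qed.

(** The nonzero part of the structure comes from C = E11^-1 A11 and from the n4
blocks of size one at infinity, so it depends neither on the third block row
of A nor on the couplings E21, A14, A21, A24.  If A32 = 0, the part of the pencil
with eigenvalue zero is z I, whose Jordan blocks all have size one. *)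
Lemma condensed_kronecker (E11 : 'M[C]_n1) (E22 : 'M_n2) (A11 : 'M_n1)
    (A44 : 'M_n4) :
  E11 \in unitmx -> E22 \in unitmx -> A11 \in unitmx -> A44 \in unitmx ->
  exists bs, forall (E21 : 'M_(n2, n1)) A14 A21 A24 (A31 : 'M_(n3, n1)) A32 A34,
  let E := col4 (row4 E11 0 0 0) (row4 E21 E22 0 0) (row4 0 0 1%:M 0)
          (row4 0 0 0 0) in
  let A := col4 (row4 A11 0 0 A14) (row4 A21 0 0 A24) (row4 A31 A32 0 A34)
          (row4 0 0 0 A44) in
  (exists2 bs', kronecker_form E A bs' & nonzero_blocks bs' = bs)
  /\ (A32 = 0 -> zero_semisimple E A).
Proof.
move=> uE1 uE2 uA1 uA4.
have uC : invmx E11 *m A11 \in unitmx by rewrite unitmx_mul unitmx_inv uE1.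
have [bsC kC eC] := jordan_form (invmx E11 *m A11).
have kinf : kronecker_form (0 : 'M[C]_n4) 1%:M (nseq n4 (None, 1%N)).
  rewrite -[0](_ : 0%:M = 0); last by rewrite -scalemx1 scale0r.
  apply: kronecker_form_nseq => //; apply/matrixP => x y.
  by rewrite !ord1 !mxE mul0rn add0r.
have nC b : b \in bsC -> b.1 != Some 0.
  by move=> /eC[a -> /(unit_eigenvalue uC)]; apply: contra_neq => -[->].
exists (bsC ++ nseq n4 (None, 1%N)) => E21 A14 A21 A24 A31 A32 A34 E A.
have eqv : pencil_equiv E A _ _ :=
  condensed_equiv E21 A14 A21 A24 A31 A32 A34 uE1 uE2 uA1 uA4.
pose Z : 'M[C]_(n2 + n3) := block_mx 0 0 A32 0.
have kform bsZ : kronecker_form 1%:M Z bsZ ->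
    kronecker_form E A (bsC ++ (bsZ ++ nseq n4 (None, 1%N))).
  move=> kZ; apply: (kronecker_form_pencil_equiv eqv).
  exact: kronecker_form_diag kC (kronecker_form_diag kZ kinf).
split.
  have [bsZ kZ eZ] := jordan_form Z.
  exists (bsC ++ (bsZ ++ nseq n4 (None, 1%N))); first exact: kform.
  rewrite /nonzero_blocks !filter_cat; congr (_ ++ _).
    by apply/all_filterP/allP => b /nC.
  rewrite [X in X ++ _](_ : _ = [::]) /=.
    by apply/all_filterP; rewrite all_nseq orbT.
  apply/eqP; rewrite -(negbK (_ == _)) -has_filter; apply/hasPn => b /eZ[a ->].
  move=> /square_zero_eigenvalue -> //; first by rewrite eqxx.
  by rewrite /Z mulmx_block !(mul0mx, mulmx0, addr0) block_mx0.
move=> A320.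
exists (bsC ++ (nseq (n2 + n3) (Some 0, 1%N) ++ nseq n4 (None, 1%N))).
  apply: kform; rewrite /Z A320 block_mx0 -[0](_ : 0%:M = 0).
    apply: kronecker_form_nseq => //; apply/matrixP => x y.
    by rewrite !ord1 !mxE mul0rn add0r.
  by rewrite -scalemx1 scale0r.
rewrite !all_cat; apply/and3P; split.
- by apply/allP => b /nC /negPf ->.
- by rewrite all_nseq /= ?implybT orbT.
- by rewrite all_nseq /= ?implybT orbT.
Qed.

End CondensedKronecker.

(** * Conjugate transposes and norms *)

Section ConjugateTranspose.
Context {C : numClosedFieldType}.

Lemma trmxC_mul m n p (A : 'M[C]_(m, n)) (B : 'M_(n, p)) :
  (A *m B)^t* = B^t* *m A^t*.
Proof. by rewrite trmx_mul map_mxM. Qed.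

Lemma trmxCD m n (A B : 'M[C]_(m, n)) : (A + B)^t* = A^t* + B^t*.
Proof. by rewrite linearD map_mxD. Qed.

Lemma trmxCN m n (A : 'M[C]_(m, n)) : (- A)^t* = - A^t*.
Proof. by rewrite linearN map_mxN. Qed.

Lemma trmxCZ m n a (A : 'M[C]_(m, n)) : (a *: A)^t* = a^* *: A^t*.
Proof. by rewrite linearZ map_mxZ. Qed.

Lemma trmxC1 n : (1%:M : 'M[C]_n)^t* = 1%:M.
Proof. by rewrite trmx1 map_mx1. Qed.

Lemma trmxC0 m n : (0 : 'M[C]_(m, n))^t* = 0.
Proof. by rewrite trmx0 map_mx0. Qed.

Lemma form_conj n (W : 'M[C]_n) (x y : 'cV_n) : W^t* = W ->
  (y^t* *m W *m x) 0 0 = ((x^t* *m W *m y) 0 0)^*.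
Proof.
move=> hW; transitivity ((x^t* *m W *m y)^t* 0 0); last by rewrite !mxE.
by rewrite !trmxC_mul trmxCK hW mulmxA.
Qed.

Lemma form_combination n (W : 'M[C]_n) (x y : 'cV_n) a b :
  ((a *: x + b *: y)^t* *m W *m (a *: x + b *: y)) 0 0 =
  a^* * a * (x^t* *m W *m x) 0 0 + a^* * b * (x^t* *m W *m y) 0 0
  + (b^* * a * (y^t* *m W *m x) 0 0 + b^* * b * (y^t* *m W *m y) 0 0).
Proof.
rewrite trmxCD !trmxCZ !mulmxDl !mulmxDr -!scalemxAl -!scalemxAr !scalerA.
have aE (A B : 'M[C]_1) : (A + B) 0 0 = A 0 0 + B 0 0 by rewrite mxE.
have sE c (A : 'M[C]_1) : (c *: A) 0 0 = c * A 0 0 by rewrite mxE.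
by rewrite !aE !sE.
Qed.

(** The form at c x - b^* y is c (a c - |b|^2), which settles the case c != 0;
symmetrically for a != 0; and if a = c = 0, the form at x - b^* y is
- 2 |b|^2. *)
Lemma form_cauchy_schwarz n (W : 'M[C]_n) (x y : 'cV_n) : W^t* = W ->
  (forall z : 'cV_n, 0 <= (z^t* *m W *m z) 0 0) ->
  `|(x^t* *m W *m y) 0 0| ^+ 2 <=
    (x^t* *m W *m x) 0 0 * (y^t* *m W *m y) 0 0.
Proof.
move=> hW W0; have yx := form_conj x y hW.
set a := (x^t* *m W *m x) 0 0; set c := (y^t* *m W *m y) 0 0.
set b := (x^t* *m W *m y) 0 0.
have a0 : 0 <= a by apply: W0. have c0 : 0 <= c by apply: W0.
have ca : a^* = a by apply/CrealP/ger0_real.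
have cc : c^* = c by apply/CrealP/ger0_real.
have key u v : 0 <= u^* * u * a + u^* * v * b + (v^* * u * b^* + v^* * v * c).
  by rewrite -yx -form_combination; apply: W0.
rewrite normCK.
have [c_eq0|c_neq0] := eqVneq c 0; last first.
  have c_gt0 : 0 < c by rewrite lt_def c_neq0.
  rewrite -subr_ge0 -(pmulr_rge0 _ c_gt0).
  have := key c (- b^*); rewrite rmorphN /= conjCK cc.
  by move=> /le_trans; apply; rewrite le_eqVlt; apply/orP/or_introl/eqP; ring.
have [a_eq0|a_neq0] := eqVneq a 0; last first.
  have a_gt0 : 0 < a by rewrite lt_def a_neq0.
  rewrite -subr_ge0 -(pmulr_rge0 _ a_gt0).
  have := key (- b) a; rewrite rmorphN /= ca.
  by move=> /le_trans; apply; rewrite le_eqVlt; apply/orP/or_introl/eqP; ring.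
have := key 1 (- b^*); rewrite a_eq0 c_eq0 rmorphN /= conjCK rmorph1.
have -> : 1 * 1 * 0 + 1 * - b^* * b + (- b * 1 * b^* + - b * - b^* * 0)
  = - (b * b^*) - b * b^* by ring.
rewrite mulr0 subr_ge0 => h; have b0 := mul_conjC_ge0 b.
by apply: (le_trans h); rewrite oppr_le0.
Qed.

End ConjugateTranspose.

Section Norms.
Context {K : realType}.
Local Notation C := K[i].

Local Notation "x %:C" := (real_complex K x).

Lemma normcE (z : C) : (Normc.normc z)%:C = `|z|.
Proof. by []. Qed.

Lemma normc_ge0 (z : C) : 0 <= Normc.normc z.
Proof. by rewrite -ler0c normcE. Qed.

Lemma euclidean_norm_ge0 n (x : 'cV[C]_n) : 0 <= euclidean_norm x.
Proof. exact: sqrtr_ge0. Qed.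

Lemma euclidean_norm2 n (x : 'cV[C]_n) :
  (euclidean_norm x ^+ 2)%:C = (x^t* *m x) 0 0.
Proof.
rewrite sqr_sqrtr ?sumr_ge0 // => [|i _]; last by rewrite exprn_ge0 ?normc_ge0.
rewrite rmorph_sum mxE; apply: eq_bigr => i _.
by rewrite rmorphXn /= normcE normCK mulrC !mxE.
Qed.

Lemma frobenius_norm_ge0 m n (A : 'M[C]_(m, n)) : 0 <= frobenius_norm A.
Proof. exact: sqrtr_ge0. Qed.

Lemma frobenius_norm2 m n (A : 'M[C]_(m, n)) :
  (frobenius_norm A ^+ 2)%:C = \tr (A^t* *m A).
Proof.
rewrite sqr_sqrtr; last first.
  by do 2!apply: sumr_ge0 => ? _; rewrite exprn_ge0 ?normc_ge0.
rewrite exchange_big rmorph_sum; apply: eq_bigr => j _.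
rewrite rmorph_sum mxE; apply: eq_bigr => i _.
by rewrite rmorphXn /= normcE normCK mulrC !mxE.
Qed.

Lemma norm_dot_le n (x y : 'cV[C]_n) :
  Normc.normc ((x^t* *m y) 0 0) <= euclidean_norm x * euclidean_norm y.
Proof.
rewrite -(ler_pXn2r (ltn0Sn 1)) ?nnegrE ?mulr_ge0 ?euclidean_norm_ge0
  ?normc_ge0 //.
rewrite -lecR exprMn [leRHS]rmorphM rmorphXn /= !euclidean_norm2 normcE.
have := @form_cauchy_schwarz _ n 1%:M x y (trmxC1 _); rewrite !mulmx1; apply.
move=> z; rewrite mulmx1 -euclidean_norm2 ler0c.
by rewrite exprn_ge0 ?euclidean_norm_ge0.
Qed.

Lemma euclidean_normZ n a (x : 'cV[C]_n) :
  euclidean_norm (a *: x) = Normc.normc a * euclidean_norm x.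
Proof.
apply: (pexpIrn (ltn0Sn 1));
  rewrite ?nnegrE ?mulr_ge0 ?euclidean_norm_ge0 ?normc_ge0 //.
apply: complexI; rewrite exprMn [RHS]rmorphM /= !euclidean_norm2.
rewrite trmxCZ -scalemxAl -scalemxAr scalerA mxE rmorphXn /= normcE normCK.
by rewrite [a * _]mulrC.
Qed.

Lemma euclidean_norm0 n : euclidean_norm (0 : 'cV[C]_n) = 0.
Proof.
by rewrite -(scale0r 0) euclidean_normZ Normc.normc0 mul0r.
Qed.

Lemma euclidean_norm_eq0 n (x : 'cV[C]_n) : euclidean_norm x = 0 -> x = 0.
Proof.
move=> x0; have := congr1 (fun a => (a ^+ 2)%:C) x0.
rewrite /= euclidean_norm2 expr0n mxE => /eqP.
rewrite psumr_eq0 => [/allP h|i _]; last by rewrite !mxE mulrC mul_conjC_ge0.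
apply/colP => i; have := h i (mem_index_enum _).
by rewrite !mxE mulrC mul_conjC_eq0 => /eqP.
Qed.

Lemma euclidean_norm_mul_le m n (A : 'M[C]_(m, n)) (x : 'cV_n) :
  euclidean_norm (A *m x) <= frobenius_norm A * euclidean_norm x.
Proof.
rewrite -(ler_pXn2r (ltn0Sn 1)) ?nnegrE ?mulr_ge0 ?euclidean_norm_ge0
  ?frobenius_norm_ge0 //.
rewrite exprMn [leLHS]sqr_sqrtr; last first.
  by apply: sumr_ge0 => i _; rewrite exprn_ge0 ?normc_ge0.
rewrite [frobenius_norm A ^+ 2]sqr_sqrtr; last first.
  by do 2!apply: sumr_ge0 => ? _; rewrite exprn_ge0 ?normc_ge0.
rewrite mulr_suml; apply: ler_sum => i _.
have -> : \sum_j Normc.normc (A i j) ^+ 2 = euclidean_norm ((row i A)^t*) ^+ 2.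
  apply: complexI; rewrite euclidean_norm2 trmxCK rmorph_sum mxE.
  apply: eq_bigr => j _.
  by rewrite rmorphXn /= normcE normCK !mxE.
rewrite -exprMn ler_pXn2r ?nnegrE ?mulr_ge0 ?euclidean_norm_ge0 ?normc_ge0 //.
by have := norm_dot_le ((row i A)^t*) x; rewrite trmxCK -row_mul [_ 0 0]mxE.
Qed.


Lemma spectral_norm_ub m n (A : 'M[C]_(m, n)) (x : 'cV_n) :
  euclidean_norm (A *m x) <= spectral_norm A * euclidean_norm x.
Proof.
have [x0|x0] := eqVneq (euclidean_norm x) 0.
  by rewrite (euclidean_norm_eq0 x0) mulmx0 !euclidean_norm0 mulr0.
have x_gt0 : 0 < euclidean_norm x by rewrite lt_def x0 euclidean_norm_ge0.
rewrite -ler_pdivrMr //; apply: ub_le_sup.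
  exists (frobenius_norm A) => _ [y /= y1 <-].
  apply: (le_trans (euclidean_norm_mul_le _ _)).
  by rewrite ler_piMr // frobenius_norm_ge0.
have nV : Normc.normc ((euclidean_norm x)^-1)%:C = (euclidean_norm x)^-1.
  by apply: complexI; rewrite normcE ger0_norm // ler0c invr_ge0 ltW.
exists (((euclidean_norm x)^-1)%:C *: x) => /=.
  by rewrite euclidean_normZ nV mulVf.
by rewrite -scalemxAr euclidean_normZ nV mulrC.
Qed.

Lemma spectral_norm_le m n (A : 'M[C]_(m, n)) c : 0 <= c ->
  (forall x, euclidean_norm (A *m x) <= c * euclidean_norm x) ->
  spectral_norm A <= c.
Proof.
move=> c0 h; apply: ge_sup.
  exists (euclidean_norm (A *m 0)), 0 => //=; by rewrite euclidean_norm0.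
by move=> _ [x /= x1 <-]; apply: (le_trans (h x)); rewrite ler_piMr.
Qed.

Lemma spectral_norm_ge0 m n (A : 'M[C]_(m, n)) : 0 <= spectral_norm A.
Proof.
rewrite -(euclidean_norm0 m) -(mulmx0 1 A); apply: ub_le_sup; last first.
  by exists 0 => //=; rewrite euclidean_norm0.
exists (frobenius_norm A) => _ [y /= y1 <-].
apply: (le_trans (euclidean_norm_mul_le _ _)).
by rewrite ler_piMr // frobenius_norm_ge0.
Qed.

Lemma spectral_normM m n p (A : 'M[C]_(m, n)) (B : 'M_(n, p)) :
  spectral_norm (A *m B) <= spectral_norm A * spectral_norm B.
Proof.
apply: spectral_norm_le => [|x]; first by rewrite mulr_ge0 ?spectral_norm_ge0.
rewrite -mulmxA -mulrA; apply: (le_trans (spectral_norm_ub _ _)).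
by rewrite ler_wpM2l ?spectral_norm_ge0 ?spectral_norm_ub.
Qed.

Lemma euclidean_normD n (x y : 'cV[C]_n) :
  euclidean_norm (x + y) <= euclidean_norm x + euclidean_norm y.
Proof.
have [->|s0] := eqVneq (euclidean_norm (x + y)) 0.
  by rewrite addr_ge0 ?euclidean_norm_ge0.
have s_gt0 : 0 < euclidean_norm (x + y) by rewrite lt_def s0 euclidean_norm_ge0.
have e : (euclidean_norm (x + y) ^+ 2)%:C =
    `|((x + y)^t* *m x) 0 0 + ((x + y)^t* *m y) 0 0|.
  rewrite -[LHS]ger0_norm ?ler0c ?exprn_ge0 ?ltW // euclidean_norm2.
  by rewrite mulmxDr [X in `|X|]mxE.
rewrite -(ler_pM2l s_gt0) mulrDr -lecR -expr2 e.
apply: (le_trans (ler_normD _ _)); rewrite rmorphD /=.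
by apply: lerD; rewrite -normcE lecR norm_dot_le.
Qed.

Lemma spectral_normD m n (A B : 'M[C]_(m, n)) :
  spectral_norm (A + B) <= spectral_norm A + spectral_norm B.
Proof.
apply: spectral_norm_le => [|x]; first by rewrite addr_ge0 ?spectral_norm_ge0.
rewrite mulmxDl mulrDl; apply: (le_trans (euclidean_normD _ _)).
by apply: lerD; apply: spectral_norm_ub.
Qed.

Lemma euclidean_normN n (x : 'cV[C]_n) :
  euclidean_norm (- x) = euclidean_norm x.
Proof.
rewrite -scaleN1r euclidean_normZ (_ : Normc.normc _ = 1) ?mul1r //.
by apply: complexI; rewrite normcE normrN1.
Qed.

Lemma spectral_normN m n (A : 'M[C]_(m, n)) :
  spectral_norm (- A) <= spectral_norm A.
Proof.
apply: spectral_norm_le => [|x]; first exact: spectral_norm_ge0.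
by rewrite mulNmx euclidean_normN spectral_norm_ub.
Qed.

Lemma spectral_norm_trC m n (A : 'M[C]_(m, n)) :
  spectral_norm (A^t*) <= spectral_norm A.
Proof.
apply: spectral_norm_le => [|x]; first exact: spectral_norm_ge0.
set y := A^t* *m x.
have [->|y0] := eqVneq (euclidean_norm y) 0.
  by rewrite mulr_ge0 ?spectral_norm_ge0 ?euclidean_norm_ge0.
have y_gt0 : 0 < euclidean_norm y by rewrite lt_def y0 euclidean_norm_ge0.
rewrite -(ler_pM2l y_gt0) -expr2.
have -> : euclidean_norm y ^+ 2 = Normc.normc ((x^t* *m (A *m y)) 0 0).
  apply: complexI; rewrite normcE mulmxA.
  have -> : x^t* *m A = y^t* by rewrite trmxC_mul trmxCK.
  rewrite -euclidean_norm2 ger0_norm // ler0c exprn_ge0 // ltW //.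
apply: (le_trans (norm_dot_le _ _)); rewrite mulrC.
rewrite [leRHS]mulrCA mulrA ler_wpM2r ?euclidean_norm_ge0 //.
exact: spectral_norm_ub.
Qed.

Lemma spectral_norm_isometry m n (A : 'M[C]_(m, n)) :
  A^t* *m A = 1%:M -> spectral_norm A <= 1.
Proof.
move=> AA; apply: spectral_norm_le => // x; rewrite mul1r.
rewrite -(ler_pXn2r (ltn0Sn 1)) ?nnegrE ?euclidean_norm_ge0 //.
rewrite -lecR !euclidean_norm2 trmxC_mul -mulmxA (mulmxA (A^t*)) AA.
by rewrite mul1mx.
Qed.

Lemma spectral_norm_conj_le m n p q (A : 'M[C]_(m, n)) (B : 'M_(n, p))
    (D : 'M_(p, q)) : spectral_norm A <= 1 -> spectral_norm D <= 1 ->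
  spectral_norm (A *m B *m D) <= spectral_norm B.
Proof.
move=> A1 D1; apply: (le_trans (spectral_normM _ _)).
apply: (@le_trans _ _ (spectral_norm (A *m B))).
  by rewrite ler_piMr ?spectral_norm_ge0.
apply: (le_trans (spectral_normM _ _)).
by rewrite ler_piMl ?spectral_norm_ge0.
Qed.

End Norms.

(** * Orthogonal projections and Hermitian pseudo-inverses *)

Section Scalars.
Context {K : realType}.
Local Notation C := K[i].
Variable F : ground_field.
Local Notation over A := (A \is a mxOver (scalars K F)).

(** In the real case, being over the ground field means being fixed by the
conjugation.  This is how the matrices below are shown to be real when they come
from constructions (orthonormal bases, projections) that involve choices. *)
Lemma fixed_over m n (A : 'M[C]_(m, n)) :
  (F = RealField -> A ^ Num.Def.conjC = A) -> over A.
Proof.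
move=> h; apply/mxOverP => i j; case: F h => //= /(_ erefl) fA.
by apply/CrealP; rewrite -{2}fA mxE.
Qed.

Lemma over_fixed m n (A : 'M[C]_(m, n)) :
  over A -> F = RealField -> A ^ Num.Def.conjC = A.
Proof. by move=> oA e; apply: realmxC; move: oA; rewrite e. Qed.

Lemma overM m n p (A : 'M[C]_(m, n)) (B : 'M_(n, p)) :
  over A -> over B -> over (A *m B).
Proof.
move=> oA oB; apply: fixed_over => e.
by rewrite map_mxM (over_fixed oA e) (over_fixed oB e).
Qed.

Lemma overD m n (A B : 'M[C]_(m, n)) : over A -> over B -> over (A + B).
Proof.
move=> oA oB; apply: fixed_over => e.
by rewrite map_mxD (over_fixed oA e) (over_fixed oB e).
Qed.

Lemma overN m n (A : 'M[C]_(m, n)) : over A -> over (- A).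
Proof.
by move=> oA; apply: fixed_over => e; rewrite map_mxN (over_fixed oA e).
Qed.

Lemma over_trC m n (A : 'M[C]_(m, n)) : over A -> over (A^t*).
Proof.
move=> oA; apply: fixed_over => e.
by rewrite -[in RHS](over_fixed oA e) !map_trmx.
Qed.

Lemma over0 m n : over (0 : 'M[C]_(m, n)).
Proof. by apply: fixed_over => _; rewrite map_mx0. Qed.

Lemma over1 n : over (1%:M : 'M[C]_n).
Proof. by apply: fixed_over => _; rewrite map_mx1. Qed.

Lemma over_row m n p (A : 'M[C]_(m, n)) (B : 'M_(m, p)) :
  over A -> over B -> over (row_mx A B).
Proof.
move=> oA oB; apply: fixed_over => e.
by rewrite map_row_mx (over_fixed oA e) (over_fixed oB e).
Qed.

Lemma over_col m n p (A : 'M[C]_(m, n)) (B : 'M_(p, n)) :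
  over A -> over B -> over (col_mx A B).
Proof.
move=> oA oB; apply: fixed_over => e.
by rewrite map_col_mx (over_fixed oA e) (over_fixed oB e).
Qed.

Lemma im_subP m n p (A : 'M[C]_(m, n)) (B : 'M[C]_(m, p)) :
  im_sub A B -> exists W, A = B *m W.
Proof.
by move=> /submxP[D e]; exists D^T; rewrite -[A]trmxK e trmx_mul trmxK.
Qed.

Lemma orthoproj_im_factor m n (Q : 'M[C]_(m, n)) :
  exists W, orthoproj_im Q = Q *m W.
Proof. by apply: im_subP; rewrite /im_sub trmxK proj_orthoE. Qed.

Lemma orthoproj_im_id m n (Q : 'M[C]_(m, n)) : orthoproj_im Q *m Q = Q.
Proof. by rewrite -[Q in LHS]trmxK -trmx_mul trmxK proj_ortho_id // trmxK. Qed.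

(** Writing P = Q W, the orthogonality Q^* (1 - P) = 0 gives P^* (1 - P) = 0,
that is P^* = P^* P. *)
Lemma orthoproj_im_herm m n (Q : 'M[C]_(m, n)) :
  (orthoproj_im Q)^t* = orthoproj_im Q.
Proof.
set P := orthoproj_im Q; have [W PE] := orthoproj_im_factor Q.
have /orthomx1P := proj_ortho_compl_sub (Q^T) 1%:M; rewrite mul1mx => h.
have {}h : Q^t* *m (1%:M - P) = 0.
  have := congr1 trmx h; rewrite trmx_mul trmx0 linearB /= trmx1 => e.
  by rewrite -[RHS]e !map_trmx trmxK.
have {}h : P^t* *m (1%:M - P) = 0.
  by rewrite {1}/P PE trmxC_mul -mulmxA h mulmx0.
have e : P^t* = P^t* *m P.
  by apply/eqP; rewrite -subr_eq0 -{1}[P^t*]mulmx1 -mulmxBr h.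
by rewrite -[RHS]trmxCK [in RHS]e trmxC_mul trmxCK -e.
Qed.

(** The conjugate of P is an orthogonal projection onto the same image, and such
a projection is unique. *)
Lemma over_orthoproj_im m n (Q : 'M[C]_(m, n)) :
  over Q -> over (orthoproj_im Q).
Proof.
move=> oQ; apply: fixed_over => e; have fQ := over_fixed oQ e.
set P := orthoproj_im Q; pose P' := P ^ Num.Def.conjC.
have [W PE] := orthoproj_im_factor Q.
have PQ : P *m Q = Q := orthoproj_im_id Q.
have hP : P^t* = P := orthoproj_im_herm Q.
have P'Q : P' *m Q = Q by rewrite -{1}fQ -map_mxM PQ fQ.
have P'P : P' *m P = P by rewrite {1 2}/P PE mulmxA P'Q.
have PP' : P *m P' = P' by rewrite /P' {2 3}/P PE map_mxM fQ mulmxA PQ.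
have hP' : P'^t* = P' by rewrite /P' -{2}hP -!map_trmx.
by rewrite -/P' -PP' -{1}hP -hP' -trmxC_mul P'P hP.
Qed.

End Scalars.

Lemma mulmx_conj_sqr (F : fieldType) n (P D : 'M[F]_n) : P \in unitmx ->
  (invmx P *m D *m P) *m (invmx P *m D *m P) = invmx P *m (D *m D) *m P.
Proof. by move=> uP; rewrite !mulmxA mulmxK. Qed.

Section PseudoInverse.
Context {K : realType}.
Local Notation C := K[i].

Lemma frobenius_norm_eq0 m n (A : 'M[C]_(m, n)) : frobenius_norm A = 0 -> A = 0.
Proof.
move=> /(congr1 (fun x => x ^+ 2)).
have h i j : 0 <= Normc.normc (A i j) ^+ 2 by rewrite exprn_ge0 ?normc_ge0.
rewrite sqr_sqrtr ?expr0n /=; last by do 2!apply: sumr_ge0 => ? _.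
move=> /eqP; rewrite psumr_eq0 => [/allP hi|i _]; last exact: sumr_ge0.
apply/matrixP => i j; have := hi i (mem_index_enum _).
rewrite /= psumr_eq0 // => /allP /(_ j (mem_index_enum _)).
by rewrite /= expf_eq0 /= => /eqP/Normc.eq0_normc ->; rewrite mxE.
Qed.

Section Basis.
Variables (n : nat) (A : 'M[C]_n).
Local Notation V := (im_onb A).

Lemma im_onb_factor : exists W, V = A *m W.
Proof.
apply: im_subP; rewrite /im_sub trmxK.
by rewrite eqmx_schmidt_free ?row_base_free // eq_row_base.
Qed.

Lemma im_onb_orthonormal : V^t* *m V = 1%:M.
Proof.
have /schmidt_unitarymx : (\rank A^T <= n)%N by apply: rank_leq_col.
move=> /(_ _ (row_base A^T)) /unitarymxP /(congr1 trmx).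
by rewrite trmx_mul trmx1 !map_trmx trmxK.
Qed.

Lemma im_onb_proj p (B : 'M_(n, p)) : im_sub B A -> V *m (V^t* *m B) = B.
Proof.
move=> BA; have /im_subP[W ->] : im_sub B V.
  apply: (submx_trans BA); rewrite trmxK.
  by rewrite eqmx_schmidt_free ?row_base_free // eq_row_base.
by rewrite (mulmxA (V^t*)) im_onb_orthonormal mul1mx.
Qed.

Hypothesis hA : A^t* = A.

Lemma herm_ker_im p (x : 'M_(n, p)) : A *m (A *m x) = 0 -> A *m x = 0.
Proof.
move=> h; suff : \tr ((A *m x)^t* *m (A *m x)) = 0.
  rewrite -frobenius_norm2 => /complexI/eqP.
  by rewrite expf_eq0 => /eqP/frobenius_norm_eq0.
by rewrite trmxC_mul hA -mulmxA h mulmx0 mxtrace0.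
Qed.

Lemma restrict_im_mul : V *m restrict_im A = A *m V.
Proof.
rewrite /restrict_im -mulmxA; apply: im_onb_proj.
by rewrite /im_sub trmx_mul submxMl.
Qed.

Lemma restrict_im_unit : restrict_im A \in unitmx.
Proof.
rewrite -unitmx_tr -row_free_unit -kermx_eq0; apply/eqP/trmx_inj; rewrite trmx0.
set k := (kermx _)^T.
have : restrict_im A *m k = 0.
  by apply: trmx_inj; rewrite trmx_mul trmxK mulmx_ker trmx0.
move=> /(congr1 (mulmx V)); rewrite mulmxA restrict_im_mul mulmx0 -mulmxA.
have [W VE] := im_onb_factor => h.
have Vk : V *m k = 0.
  by rewrite VE -mulmxA; apply: herm_ker_im; rewrite (mulmxA A W) -VE.
by rewrite -[k]mul1mx -im_onb_orthonormal -mulmxA Vk mulmx0.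
Qed.

Lemma restrict_im_herm : (restrict_im A)^t* = restrict_im A.
Proof. by rewrite !trmxC_mul trmxCK hA mulmxA. Qed.

End Basis.

Lemma sqrt_psd_sqr n (S : 'M[C]_n) : S^t* = S -> sqrt_psd S *m sqrt_psd S = S.
Proof.
move=> hS; have uS := spectral_unit S.
set D := map_mx sqrtC (spectral_diag S).
have DD : diag_mx D *m diag_mx D = diag_mx (spectral_diag S).
  rewrite mulmx_diag; congr diag_mx; apply/rowP => j.
  by rewrite !mxE -expr2 sqrtCK.
have nS : S \is normalmx by apply/normalmxP; rewrite hS.
rewrite /sqrt_psd -/D (mulmx_conj_sqr _ uS) DD.
exact/esym/(orthomx_spectralP nS).
Qed.

Lemma spectral_norm_inv_le n (S : 'M[C]_n) : S^t* = S -> S \in unitmx ->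
  spectral_norm (invmx S) <= spectral_norm (invmx (sqrt_psd S)) ^+ 2.
Proof.
move=> hS uS; have e := sqrt_psd_sqr hS.
have uq : sqrt_psd S \in unitmx.
  by move: uS; rewrite -{1}e unitmx_mul => /andP[].
have -> : invmx S = invmx (sqrt_psd S) *m invmx (sqrt_psd S).
  apply: (row_full_inj (A := S)); first by rewrite row_full_unit.
  by rewrite mulmxV // -{1}e -mulmxA (mulmxA (sqrt_psd S) (invmx _)) mulmxV //
    mul1mx mulmxV.
exact: spectral_normM.
Qed.

(** M is the pseudo-inverse of A applied to Y^*, written as V S^-1 V^* Y^* with
V an orthonormal basis of im A and S = V^* A V.  It is the only solution of
A M = Y^* with image in im A, so it is its own conjugate when A and Y are
real. *)
Lemma hermitian_solve F n m (A : 'M[C]_n) (Y : 'M[C]_(m, n)) :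
  A^t* = A -> im_sub (Y^t*) A ->
  exists M : 'M[C]_(n, m),
  [/\ A *m M = Y^t*,
      spectral_norm (Y *m M) <=
        spectral_norm (invmx (restrict_im A)) * spectral_norm Y ^+ 2
    & A \is a mxOver (scalars K F) -> Y \is a mxOver (scalars K F) ->
      M \is a mxOver (scalars K F)].
Proof.
move=> hA YA; have uS := restrict_im_unit hA.
have [W VE] := im_onb_factor A; set V := im_onb A in VE.
pose M := V *m invmx (restrict_im A) *m (V^t* *m Y^t*).
have AM : A *m M = Y^t*.
  by rewrite /M !mulmxA -restrict_im_mul mulmxK // -mulmxA im_onb_proj.
exists M; split=> //.
  rewrite /M -trmxC_mul mulmxA mulmxA; set B := Y *m V.
  have BY : spectral_norm B <= spectral_norm Y.
    apply: (le_trans (spectral_normM _ _)).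
    rewrite ler_piMr ?spectral_norm_ge0 //.
    exact/spectral_norm_isometry/im_onb_orthonormal.
  apply: (le_trans (spectral_normM _ _)).
  rewrite expr2 mulrA.
  apply: ler_pM; rewrite ?spectral_norm_ge0 //; last first.
    exact: le_trans (spectral_norm_trC _) BY.
  apply: (le_trans (spectral_normM _ _)).
  by rewrite mulrC ler_wpM2l ?spectral_norm_ge0.
move=> oA oY; apply: fixed_over => e.
have fA := over_fixed oA e; have fY := over_fixed oY e.
have ME : exists Z, M = A *m Z.
  exists (W *m invmx (restrict_im A) *m (V^t* *m Y^t*)).
  by rewrite /M VE !mulmxA.
have [Z ZE] := ME.
have AM' : A *m (M ^ Num.Def.conjC)%sesqui = Y^t*.
  by rewrite -{1}fA -map_mxM AM -{2}fY !map_trmx -map_mx_comp.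
apply/eqP; rewrite -subr_eq0; apply/eqP.
have AZ : A *m (Z ^ Num.Def.conjC)%sesqui = (M ^ Num.Def.conjC)%sesqui.
  by rewrite ZE map_mxM fA.
have -> : (M ^ Num.Def.conjC)%sesqui - M =
    A *m ((Z ^ Num.Def.conjC)%sesqui - Z) by rewrite mulmxBr -ZE AZ.
by apply: (herm_ker_im hA); rewrite mulmxBr AZ -ZE mulmxBr AM AM' subrr.
Qed.

End PseudoInverse.

(** * Perturbations of semidefinite and skew-Hermitian matrices *)

(** Positivity of the perturbed matrix is seen without Schur complements: it is
congruent to R. *)
Lemma completion_identity (C : numClosedFieldType) n p q (R : 'M[C]_n)
    (e0 : 'M_(n, p)) (e3 : 'M_(n, q)) (Y : 'M_(q, p)) (M : 'M_(p, q))
    (R0 : 'M_p) (r : 'M_(q, p)) :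
  R^t* = R -> R0^t* = R0 -> R *m e0 = e0 *m R0 + e3 *m r ->
  e0^t* *m R *m e0 = R0 -> R0 *m M = Y^t* ->
  R + (e3 *m (Y *m M - (r *m M + (r *m M)^t*)) *m e3^t*
       - (e3 *m Y *m e0^t* + (e3 *m Y *m e0^t*)^t*)) =
  (1%:M - e0 *m M *m e3^t*)^t* *m R *m (1%:M - e0 *m M *m e3^t*).
Proof.
move=> hR hR0 Re0 eRe R0M.
have MR0 : M^t* *m R0 = Y by rewrite -[RHS]trmxCK -R0M trmxC_mul hR0.
rewrite trmxCD trmxCN trmxC1; set N := e0 *m M *m e3^t*.
have RN : R *m N = (e3 *m Y *m e0^t*)^t* + e3 *m (r *m M) *m e3^t*.
  by rewrite /N !mulmxA Re0 !mulmxDl -(mulmxA e0) R0M !trmxC_mul trmxCK !mulmxA.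
have NR : N^t* *m R = e3 *m Y *m e0^t* + e3 *m (r *m M)^t* *m e3^t*.
  rewrite -{1}hR -trmxC_mul RN trmxCD trmxCK; congr (_ + _).
  by rewrite !trmxC_mul trmxCK !mulmxA.
have NRN : N^t* *m R *m N = e3 *m (Y *m M) *m e3^t*.
  by rewrite /N !trmxC_mul trmxCK -MR0 -eRe !mulmxA.
rewrite [in RHS]mulmxBl mul1mx [in RHS]mulmxBr mulmx1 [in RHS]mulmxBl NRN NR RN.
rewrite mulmxBr mulmxBl mulmxDr mulmxDl.
set a := e3 *m Y *m _; set b := e3 *m (r *m M) *m _.
set c := e3 *m (r *m M)^t* *m _; set d := e3 *m _ *m _; move: (a^t*) => a'.
by clearbody a b c d; apply/matrixP => i j; rewrite !mxE; ring.
Qed.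

Lemma completion_square_bound (K : realFieldType) (rho h y : K) :
  0 <= rho -> 0 <= y ->
  rho * (h ^+ 2 * y ^+ 2) <= h ^+ 2 * y * (rho + y) ^+ 2.
Proof.
move=> rho0 y0; rewrite mulrCA -[leRHS]mulrA.
apply: ler_wpM2l; first exact: sqr_ge0.
rewrite -subr_ge0.
have -> : y * (rho + y) ^+ 2 - rho * y ^+ 2 =
  y * (rho ^+ 2 + rho * y + y ^+ 2) by ring.
by rewrite mulr_ge0 // !addr_ge0 ?exprn_ge0 // mulr_ge0.
Qed.

Lemma completion_bound (K : realFieldType) (s rho y k : K) h q :
  0 <= s -> 0 <= rho -> 0 <= y ->
  k = h * q * (rho + y) ->
  s * y ^+ 2 + (k + k) + (y + y) <= 2 * y + (s * y + 2 * h * q) * (rho + y).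
Proof.
move=> s0 rho0 y0 ->; rewrite -subr_ge0.
have -> : 2 * y + (s * y + 2 * h * q) * (rho + y) -
    (s * y ^+ 2 + (h * q * (rho + y) + h * q * (rho + y)) + (y + y)) =
  s * y * rho by ring.
by rewrite !mulr_ge0.
Qed.

Section Completion.
Context {K : realType}.
Local Notation C := K[i].
Local Notation "x %:C" := (real_complex K x).

Lemma spectral_normD_le m n (A B : 'M[C]_(m, n)) a b :
  spectral_norm A <= a -> spectral_norm B <= b ->
  spectral_norm (A + B) <= a + b.
Proof. by move=> Aa Bb; apply: le_trans (spectral_normD _ _) (lerD Aa Bb). Qed.

Lemma spectral_normB_le m n (A B : 'M[C]_(m, n)) a b :
  spectral_norm A <= a -> spectral_norm B <= b ->
  spectral_norm (A - B) <= a + b.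
Proof.
move=> Aa Bb; apply: spectral_normD_le Aa _.
exact: le_trans (spectral_normN _) Bb.
Qed.

Lemma form_le n (A : 'M[C]_n) (x : 'cV_n) :
  `|(x^t* *m A *m x) 0 0| <= (spectral_norm A * euclidean_norm x ^+ 2)%:C.
Proof.
rewrite -normcE lecR -mulmxA; apply: (le_trans (norm_dot_le _ _)).
rewrite mulrC expr2 mulrA ler_wpM2r ?euclidean_norm_ge0 //.
exact: spectral_norm_ub.
Qed.

(** The Cauchy-Schwarz inequality of the form R, applied to a w and b x. *)
Lemma psd_offdiag_le n p q (R : 'M[C]_n) (a : 'M_(n, p)) (b : 'M_(n, q)) :
  psdmx R ->
  spectral_norm (a^t* *m R *m b) ^+ 2 <=
    spectral_norm (a^t* *m R *m a) * spectral_norm (b^t* *m R *m b).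
Proof.
move=> [hR R0].
set r := a^t* *m R *m b; set ra := spectral_norm (a^t* *m R *m a).
set rb := spectral_norm (b^t* *m R *m b).
have ra0 : 0 <= ra by apply: spectral_norm_ge0.
have rb0 : 0 <= rb by apply: spectral_norm_ge0.
suff : spectral_norm r <= Num.sqrt (ra * rb).
  rewrite -(ler_pXn2r (ltn0Sn 1)) ?nnegrE ?spectral_norm_ge0 ?sqrtr_ge0 //.
  by rewrite sqr_sqrtr ?mulr_ge0.
apply: spectral_norm_le => [|x]; first exact: sqrtr_ge0.
set w := r *m x.
have [->|w0] := eqVneq (euclidean_norm w) 0.
  by rewrite mulr_ge0 ?sqrtr_ge0 ?euclidean_norm_ge0.
have w_gt0 : 0 < euclidean_norm w ^+ 2.
  by rewrite exprn_gt0 // lt_def w0 euclidean_norm_ge0.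
rewrite -(ler_pXn2r (ltn0Sn 1)) ?nnegrE ?mulr_ge0 ?euclidean_norm_ge0
  ?sqrtr_ge0 //.
rewrite exprMn (sqr_sqrtr (mulr_ge0 ra0 rb0)) -(ler_pM2l w_gt0).
have e : (euclidean_norm w ^+ 2)%:C = `|((a *m w)^t* *m R *m (b *m x)) 0 0|.
  rewrite -[LHS]ger0_norm ?ler0c ?(ltW w_gt0) //; congr `|_|.
  rewrite euclidean_norm2.
  by rewrite trmxC_mul !mulmxA -!(mulmxA (w^t*)) {1}/w /r !mulmxA.
have := form_cauchy_schwarz (a *m w) (b *m x) hR R0.
rewrite -e expr2 -rmorphM /= => h; rewrite -lecR; apply: (le_trans h).
have -> : euclidean_norm w ^+ 2 * (ra * rb * euclidean_norm x ^+ 2) =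
  (ra * euclidean_norm w ^+ 2) * (rb * euclidean_norm x ^+ 2) by ring.
rewrite rmorphM /=; apply: ler_pM; rewrite ?R0 //.
  rewrite -[leLHS]ger0_norm ?R0 // trmxC_mul.
  suff -> : w^t* *m a^t* *m R *m (a *m w) = w^t* *m (a^t* *m R *m a) *m w.
    exact: form_le.
  by rewrite !mulmxA.
rewrite -[leLHS]ger0_norm ?R0 // trmxC_mul.
suff -> : x^t* *m b^t* *m R *m (b *m x) = x^t* *m (b^t* *m R *m b) *m x.
  exact: form_le.
by rewrite !mulmxA.
Qed.

(** The columns of e0 and e3 form an orthonormal basis in which R has diagonal
blocks R0, R33 and off-diagonal block r.  With R0 M = Y^* and T = 1 - e0 M e3^*
one has T e0 = e0 and T e3 = e3 - e0 M, so that passing from R to T^* R T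
keeps R0, replaces r by r - Y, and adds Z = Y M - r M - (r M)^* to R33.  Here
|Y M| is at most |S^-1| |Y|^2, where S is R0 restricted to its image, and
|r M|^2 is at most |R33| |Y M| because Y M = M^* R0 M. *)
Lemma psd_completion F n p q (R : 'M[C]_n) (e0 : 'M_(n, p)) (e3 : 'M_(n, q))
    (Y : 'M_(q, p)) :
  let R0 := e0^t* *m R *m e0 in let R33 := e3^t* *m R *m e3 in
  psdmx R -> e0^t* *m e0 = 1%:M -> e3^t* *m e3 = 1%:M -> e3^t* *m e0 = 0 ->
  e0 *m e0^t* + e3 *m e3^t* = 1%:M -> im_sub (Y^t*) R0 ->
  exists D : 'M[C]_n,
  [/\ D^t* = D, psdmx (R + D), D *m e0 = - (e3 *m Y),
    R \is a mxOver (scalars K F) -> e0 \is a mxOver (scalars K F) ->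
    e3 \is a mxOver (scalars K F) -> Y \is a mxOver (scalars K F) ->
    D \is a mxOver (scalars K F)
  & spectral_norm D <=
      2 * spectral_norm Y
      + (spectral_norm (invmx (restrict_im R0)) * spectral_norm Y
         + 2 * spectral_norm (invmx (sqrt_psd (restrict_im R0)))
             * Num.sqrt (spectral_norm Y))
        * (spectral_norm R33 + spectral_norm Y)].
Proof.
move=> R0 R33 hR i0 i3 i30 i1 YR0; have hRC := hR.1.
have hR0 : R0^t* = R0 by rewrite !trmxC_mul trmxCK hRC mulmxA.
have [M [R0M YM oM]] := hermitian_solve F hR0 YR0.
have [r rE] : {r | r = e3^t* *m R *m e0} by exists (e3^t* *m R *m e0).
pose Z := Y *m M - (r *m M + (r *m M)^t*).
pose D := e3 *m Z *m e3^t* - (e3 *m Y *m e0^t* + (e3 *m Y *m e0^t*)^t*).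
have Re0 : R *m e0 = e0 *m R0 + e3 *m r.
  by rewrite -[R in LHS]mul1mx -i1 !mulmxDl rE !mulmxA.
have RD := completion_identity hRC hR0 Re0 (erefl _) R0M.
have hYM : (Y *m M)^t* = Y *m M.
  by rewrite trmxC_mul -[Y in LHS]trmxCK -R0M trmxCK mulmxA -[in RHS](trmxCK Y)
    -R0M trmxC_mul hR0.
have hD : D^t* = D.
  have hZ : Z^t* = Z.
    by rewrite /Z trmxCD trmxCN trmxCD trmxCK hYM [_^t* + _]addrC.
  have hA (A B : 'M[C]_n) : A^t* = A -> (A - (B + B^t*))^t* = A - (B + B^t*).
    by move=> e; rewrite trmxCD trmxCN trmxCD trmxCK e [_^t* + _]addrC.
  by apply: hA; rewrite !trmxC_mul trmxCK hZ mulmxA.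
have n1_le m k (e : 'M[C]_(m, k)) : e^t* *m e = 1%:M ->
    spectral_norm e <= 1 /\ spectral_norm (e^t*) <= 1.
  move=> ee; have e1 := spectral_norm_isometry ee; split=> //.
  exact: le_trans (spectral_norm_trC _) e1.
have [s0 s0'] := n1_le _ _ _ i0; have [s3 s3'] := n1_le _ _ _ i3.
exists D; split; first exact: hD.
- split; first by rewrite trmxCD hRC hD.
  move=> x; rewrite /D RD; set T := 1%:M - _.
  have -> : x^t* *m (T^t* *m R *m T) *m x = (T *m x)^t* *m R *m (T *m x).
    by rewrite trmxC_mul !mulmxA.
  exact: hR.2.
- rewrite /D mulmxBl mulmxDl !trmxC_mul trmxCK -!mulmxA i30 i0.
  by rewrite !mulmx0 mulmx1 sub0r addr0.
- move=> oR oe0 oe3 oY.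
  have oR0 : R0 \is a mxOver (scalars K F) by rewrite !overM ?over_trC.
  have {}oM := oM oR0 oY.
  have or : r \is a mxOver (scalars K F) by rewrite rE !overM ?over_trC.
  by rewrite /D /Z !(overD, overN, overM, over_trC).
- set y := spectral_norm Y; set h := spectral_norm (invmx (sqrt_psd _)).
  set s := spectral_norm (invmx (restrict_im R0)) in YM *.
  set rho := spectral_norm R33.
  have y0 : 0 <= y by apply: spectral_norm_ge0.
  have h0 : 0 <= h by apply: spectral_norm_ge0.
  have s_ge0 : 0 <= s by apply: spectral_norm_ge0.
  have rho0 : 0 <= rho by apply: spectral_norm_ge0.
  have sh : s <= h ^+ 2.
    exact: spectral_norm_inv_le (restrict_im_herm hR0) (restrict_im_unit hR0).
  have rM : spectral_norm (r *m M) <= h * Num.sqrt y * (rho + y).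
    rewrite -(ler_pXn2r (ltn0Sn 1)) ?nnegrE ?mulr_ge0 ?addr_ge0
      ?spectral_norm_ge0 ?sqrtr_ge0 //.
    rewrite !exprMn (sqr_sqrtr y0).
    have := psd_offdiag_le e3 (e0 *m M) hR; rewrite -/R33 -/rho.
    have -> : e3^t* *m R *m (e0 *m M) = r *m M by rewrite rE !mulmxA.
    have -> : (e0 *m M)^t* *m R *m (e0 *m M) = Y *m M.
      by rewrite -hYM [RHS]trmxC_mul -R0M trmxC_mul /R0 !mulmxA.
    move=> le1; apply: (le_trans le1).
    apply: (@le_trans _ _ (rho * (h ^+ 2 * y ^+ 2))).
      by rewrite ler_wpM2l // (le_trans YM) // ler_wpM2r // exprn_ge0.
    exact: completion_square_bound.
  have Y1 := spectral_norm_conj_le Y s3 s0'.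
  have Y2 := le_trans (spectral_norm_trC _) Y1.
  have rM' := le_trans (spectral_norm_trC _) rM.
  have ZZ := spectral_normB_le YM (spectral_normD_le rM rM').
  have ZD := le_trans (spectral_norm_conj_le Z s3 s3') ZZ.
  have DD := spectral_normB_le ZD (spectral_normD_le Y1 Y2).
  apply: (le_trans DD); exact: completion_bound s_ge0 rho0 y0 (erefl _).
Qed.

(** As G e3 = 0, the two summands are orthogonal for the trace form. *)
Lemma frobenius_skew n q (e3 : 'M[C]_(n, q)) (G : 'M_(q, n)) :
  e3^t* *m e3 = 1%:M -> G *m e3 = 0 ->
  frobenius_norm (e3 *m G - (e3 *m G)^t*) <= 2 * frobenius_norm G.
Proof.
move=> i3 Ge.
rewrite -(ler_pXn2r (ltn0Sn 1)) ?nnegrE ?mulr_ge0 ?frobenius_norm_ge0 //.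
set D := e3 *m G - _.
have -> : frobenius_norm D ^+ 2 = frobenius_norm G ^+ 2 + frobenius_norm G ^+ 2.
  apply: complexI; rewrite [RHS]rmorphD /= !frobenius_norm2 /D.
  have eG : e3^t* *m (e3 *m G) = G by rewrite mulmxA i3 mul1mx.
  rewrite trmxCD trmxCN trmxCK mulmxDl !mulmxDr !(mulmxN, mulNmx).
  have -> : (e3 *m G)^t* *m (e3 *m G) = G^t* *m G.
    by rewrite trmxC_mul -mulmxA eG.
  have -> : (e3 *m G)^t* *m (e3 *m G)^t* = 0.
    by rewrite -trmxC_mul mulmxA -(mulmxA e3) Ge mulmx0 mul0mx trmxC0.
  have -> : e3 *m G *m (e3 *m G) = 0.
    by rewrite mulmxA -(mulmxA e3) Ge mulmx0 mul0mx.
  rewrite !oppr0 opprK addr0 add0r mxtraceD.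
  by rewrite [X in _ + X]mxtrace_mulC trmxC_mul -mulmxA eG.
have := exprn_ge0 2 (frobenius_norm_ge0 G); rewrite exprMn; lra.
Qed.

Lemma frobenius_norm_unitary m n (A : 'M[C]_(m, n)) (U : 'M_n) :
  U \is unitarymx -> frobenius_norm (A *m U) = frobenius_norm A.
Proof.
move=> /unitarymxP uU.
apply: (pexpIrn (ltn0Sn 1)); rewrite ?nnegrE ?frobenius_norm_ge0 //.
apply: complexI; rewrite !frobenius_norm2 trmxC_mul mxtrace_mulC.
by rewrite mulmxA -(mulmxA A) uU mulmx1 mxtrace_mulC.
Qed.

Lemma frobenius_norm_trC m n (A : 'M[C]_(m, n)) :
  frobenius_norm (A^t*) = frobenius_norm A.
Proof.
apply: (pexpIrn (ltn0Sn 1)); rewrite ?nnegrE ?frobenius_norm_ge0 //.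
by apply: complexI; rewrite !frobenius_norm2 trmxCK mxtrace_mulC.
Qed.

Lemma frobenius_normN m n (A : 'M[C]_(m, n)) :
  frobenius_norm (- A) = frobenius_norm A.
Proof.
apply: (pexpIrn (ltn0Sn 1)); rewrite ?nnegrE ?frobenius_norm_ge0 //.
by apply: complexI; rewrite !frobenius_norm2 trmxCN mulNmx mulmxN opprK.
Qed.

End Completion.

(** * Selection of block coordinates *)

Section Selection.
Context {C : numClosedFieldType}.
Variables n1 n2 n3 n4 : nat.
Local Notation n := (n1 + (n2 + (n3 + n4)))%N.
Local Notation p := (n1 + (n2 + n4))%N.

Lemma mul_col3 m q (B1 : 'M[C]_(n1, m)) (B2 : 'M_(n2, m)) (B4 : 'M_(n4, m))
  (A : 'M_(m, q)) :
  col3 B1 B2 B4 *m A = col3 (B1 *m A) (B2 *m A) (B4 *m A).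
Proof. by rewrite /col3 !mul_col_mx. Qed.

Lemma add_col3 m (B1 : 'M[C]_(n1, m)) (B2 : 'M_(n2, m)) (B4 : 'M_(n4, m))
  A1 A2 A4 : col3 B1 B2 B4 + col3 A1 A2 A4 = col3 (B1 + A1) (B2 + A2) (B4 + A4).
Proof. by rewrite /col3 !add_col_mx. Qed.

Lemma mul_mx_row3 m q (A : 'M_(q, m)) (B1 : 'M[C]_(m, n1)) (B2 : 'M_(m, n2))
  (B4 : 'M_(m, n4)) :
  A *m row3 B1 B2 B4 = row3 (A *m B1) (A *m B2) (A *m B4).
Proof. by rewrite /row3 !mul_mx_row. Qed.

Lemma add_row3 m (B1 : 'M[C]_(m, n1)) (B2 : 'M_(m, n2)) (B4 : 'M_(m, n4))
  A1 A2 A4 : row3 B1 B2 B4 + row3 A1 A2 A4 = row3 (B1 + A1) (B2 + A2) (B4 + A4).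
Proof. by rewrite /row3 !add_row_mx. Qed.

Lemma mul_row3_col3 m q (B1 : 'M[C]_(m, n1)) (B2 : 'M_(m, n2)) (B4 : 'M_(m, n4))
  (A1 : 'M_(n1, q)) A2 A4 :
  row3 B1 B2 B4 *m col3 A1 A2 A4 = B1 *m A1 + (B2 *m A2 + B4 *m A4).
Proof. by rewrite /row3 /col3 !mul_row_col. Qed.

(** The isometric embeddings of the coordinates of the blocks 1, 2, 4 and of the
block 3.  They replace a permutation of the blocks of R by which R0 would become
a leading submatrix. *)
Definition sel124 : 'M[C]_(n, p) :=
  col4 (row3 1%:M 0 0) (row3 0 1%:M 0) 0 (row3 0 0 1%:M).
Definition sel3 : 'M[C]_(n, n3) := col4 0 0 1%:M 0.

Lemma trC_col4 m (B1 : 'M[C]_(n1, m)) (B2 : 'M_(n2, m)) (B3 : 'M_(n3, m))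
  (B4 : 'M_(n4, m)) :
  (col4 B1 B2 B3 B4)^t* = row4 (B1^t*) (B2^t*) (B3^t*) (B4^t*).
Proof. by rewrite /col4 /row4 !tr_col_mx !map_row_mx. Qed.

Lemma trC_row3 m (B1 : 'M[C]_(m, n1)) (B2 : 'M_(m, n2)) (B4 : 'M_(m, n4)) :
  (row3 B1 B2 B4)^t* = col3 (B1^t*) (B2^t*) (B4^t*).
Proof. by rewrite /col3 /row3 !tr_row_mx !map_col_mx. Qed.

Lemma sel124_trC :
  sel124^t* = row4 (col3 1%:M 0 0) (col3 0 1%:M 0) 0 (col3 0 0 1%:M).
Proof. by rewrite trC_col4 !trC_row3 !trmxC1 !trmxC0. Qed.

Lemma sel3_trC : sel3^t* = row4 0 0 1%:M 0.
Proof. by rewrite trC_col4 !trmxC1 !trmxC0. Qed.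

Definition selE := (@mul_col4 C, @mul_row4 C, @mul_mx_row4 C, @add_row4 C,
  mul_col3,
  add_col3, mul_mx_row3, add_row3, @mul0mx C, @mulmx0 C, @mul1mx C,
  @mulmx1 C, @addr0, @add0r).

Lemma sel124_mul m (B1 : 'M[C]_(n1, m)) B2 B3 B4 :
  sel124^t* *m col4 B1 B2 B3 B4 = col3 B1 B2 B4.
Proof. by rewrite sel124_trC !selE. Qed.

Lemma sel3_mul m (B1 : 'M[C]_(n1, m)) B2 B3 B4 :
  sel3^t* *m col4 B1 B2 B3 B4 = B3.
Proof. by rewrite sel3_trC !selE. Qed.

Lemma mul_sel124 m (B1 : 'M[C]_(m, n1)) B2 B3 B4 :
  row4 B1 B2 B3 B4 *m sel124 = row3 B1 B2 B4.
Proof. by rewrite /sel124 !selE. Qed.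

Lemma mul_sel3 m (B1 : 'M[C]_(m, n1)) B2 B3 B4 :
  row4 B1 B2 B3 B4 *m sel3 = B3.
Proof. by rewrite /sel3 !selE. Qed.

Lemma row3_sel124 m (Y1 : 'M[C]_(m, n1)) Y2 Y4 :
  row3 Y1 Y2 Y4 *m sel124^t* = row4 Y1 Y2 0 Y4.
Proof.
by rewrite sel124_trC mul_mx_row4 !mul_row3_col3 !selE.
Qed.

Lemma sel124_1 : sel124^t* *m sel124 = 1%:M.
Proof.
rewrite sel124_mul /col3 /row3 (scalar_mx_block n1) (scalar_mx_block n2).
by rewrite /block_mx !row_mx0 !col_mx_row0.
Qed.

Lemma sel3_1 : sel3^t* *m sel3 = 1%:M.
Proof. by rewrite sel3_mul. Qed.

Lemma sel3_124 : sel3^t* *m sel124 = 0.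
Proof. by rewrite sel3_mul. Qed.

Lemma sel_complete : sel124 *m sel124^t* + sel3 *m sel3^t* = 1%:M.
Proof.
rewrite -col4_1 /sel124 !mul_col4 !row3_sel124 mul0mx sel3_trC !mul0mx mul1mx.
by rewrite /col4 !add_col_mx !(add0r, addr0).
Qed.

End Selection.

(** * Distance to a semisimple eigenvalue zero *)

Lemma over_half (K : realType) F m n (A : 'M[K[i]]_(m, n)) :
  A + A \is a mxOver (scalars K F) -> A \is a mxOver (scalars K F).
Proof.
move=> oA; apply: fixed_over => e; have := over_fixed oA e.
rewrite map_mxD => h; apply/matrixP => i j.
have dE (B : 'M[K[i]]_(m, n)) : (B + B) i j = B i j * 2.
  by rewrite mxE mulr_natr mulr2n.
have := congr1 (fun B : 'M_(m, n) => B i j) h; rewrite /= !dE.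
by apply: mulIf; rewrite pnatr_eq0.
Qed.

Lemma row4_split (T : Type) m n1 n2 n3 n4
    (A : 'M[T]_(m, n1 + (n2 + (n3 + n4)))) :
  exists A1 A2 A3 A4, A = row4 A1 A2 A3 A4.
Proof.
exists (lsubmx A), (lsubmx (rsubmx A)), (lsubmx (rsubmx (rsubmx A))),
  (rsubmx (rsubmx (rsubmx A))).
by rewrite /row4 !hsubmxK.
Qed.

Lemma row4_inj (T : Type) m n1 n2 n3 n4 (A1 B1 : 'M[T]_(m, n1))
    (A2 B2 : 'M_(m, n2)) (A3 B3 : 'M_(m, n3)) (A4 B4 : 'M_(m, n4)) :
  row4 A1 A2 A3 A4 = row4 B1 B2 B3 B4 ->
  [/\ A1 = B1, A2 = B2, A3 = B3 & A4 = B4].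
Proof. by move=> /eq_row_mx[-> /eq_row_mx[-> /eq_row_mx[-> ->]]]. Qed.

Lemma col4_inj (T : Type) m n1 n2 n3 n4 (A1 B1 : 'M[T]_(n1, m))
    (A2 B2 : 'M_(n2, m)) (A3 B3 : 'M_(n3, m)) (A4 B4 : 'M_(n4, m)) :
  col4 A1 A2 A3 A4 = col4 B1 B2 B3 B4 ->
  [/\ A1 = B1, A2 = B2, A3 = B3 & A4 = B4].
Proof. by move=> /eq_col_mx[-> /eq_col_mx[-> /eq_col_mx[-> ->]]]. Qed.

Theorem theorem37 (K : realType) (F : ground_field) (n1 n2 n3 n4 : nat)
  (n := (n1 + (n2 + (n3 + n4)))%N)
  (E Q L : 'M[K[i]]_n)
  (hE : E \is a mxOver (scalars K F))
  (hQ : Q \is a mxOver (scalars K F))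
  (hL : L \is a mxOver (scalars K F))
  (hEQ : E^t* *m Q = Q^t* *m E)
  (hEQ0 : psdmx (E^t* *m Q))
  (hL0 : nsdmx (L + L^t*))
  (hreg : regular_pencil E (L *m Q))
  (hind : exists2 nu : nat, pencil_index E (L *m Q) nu & (nu <= 1)%N)
  (J R : 'M[K[i]]_n)
  (hJR : L = J - R)
  (hJ : J = - J^t*)
  (hR : R = R^t*)
  (hR0 : psdmx R)
  (* the given condensed form *)
  (U X : 'M[K[i]]_n)
  (hUF : U \is a mxOver (scalars K F))
  (hXF : X \is a mxOver (scalars K F))
  (hU : U \is unitarymx)
  (hX : X \in unitmx)
  (Q11 : 'M[K[i]]_(n1, n1)) (Q12 : 'M[K[i]]_(n1, n2))
  (Q21 : 'M[K[i]]_(n2, n1)) (Q22 : 'M[K[i]]_(n2, n2))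
  (Q41 : 'M[K[i]]_(n4, n1)) (Q42 : 'M[K[i]]_(n4, n2))
  (hUQX : U *m Q *m X =
     col4 (row4 Q11 Q12 0 0)
          (row4 Q21 Q22 0 0)
          (row4 0   0   0 0)
          (row4 Q41 Q42 0 1%:M))
  (E11 : 'M[K[i]]_(n1, n1)) (E21 : 'M[K[i]]_(n2, n1)) (E22 : 'M[K[i]]_(n2, n2))
  (hUEX : U *m E *m X =
     col4 (row4 E11 0   0    0)
          (row4 E21 E22 0    0)
          (row4 0   0   1%:M 0)
          (row4 0   0   0    0))
  (A11 : 'M[K[i]]_(n1, n1)) (A14 : 'M[K[i]]_(n1, n4))
  (A21 : 'M[K[i]]_(n2, n1)) (A24 : 'M[K[i]]_(n2, n4))
  (A31 : 'M[K[i]]_(n3, n1)) (A32 : 'M[K[i]]_(n3, n2)) (A34 : 'M[K[i]]_(n3, n4))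
  (A44 : 'M[K[i]]_(n4, n4))
  (hULQX : U *m (L *m Q) *m X =
     col4 (row4 A11 0   0 A14)
          (row4 A21 0   0 A24)
          (row4 A31 A32 0 A34)
          (row4 0   0   0 A44))
  (hE11 : is_trig_mx E11 /\ E11 \in unitmx)
  (hE22 : is_trig_mx E22 /\ E22 \in unitmx)
  (hA11 : is_trig_mx A11 /\ A11 \in unitmx)
  (hA44 : A44 \in unitmx)
  (hQ4 : block_mx Q11 Q12 Q21 Q22 \in unitmx)
  (* the blocks of L and R in the condensed coordinates *)
  (L11 : 'M[K[i]]_(n1, n1)) (L12 : 'M[K[i]]_(n1, n2))
  (L13 : 'M[K[i]]_(n1, n3)) (L14 : 'M[K[i]]_(n1, n4))
  (L21 : 'M[K[i]]_(n2, n1)) (L22 : 'M[K[i]]_(n2, n2))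
  (L23 : 'M[K[i]]_(n2, n3)) (L24 : 'M[K[i]]_(n2, n4))
  (L31 : 'M[K[i]]_(n3, n1)) (L32 : 'M[K[i]]_(n3, n2))
  (L33 : 'M[K[i]]_(n3, n3)) (L34 : 'M[K[i]]_(n3, n4))
  (L41 : 'M[K[i]]_(n4, n1)) (L42 : 'M[K[i]]_(n4, n2))
  (L43 : 'M[K[i]]_(n4, n3)) (L44 : 'M[K[i]]_(n4, n4))
  (hULU : U *m L *m U^t* =
     col4 (row4 L11 L12 L13 L14)
          (row4 L21 L22 L23 L24)
          (row4 L31 L32 L33 L34)
          (row4 L41 L42 L43 L44))
  (R11 : 'M[K[i]]_(n1, n1)) (R12 : 'M[K[i]]_(n1, n2))
  (R13 : 'M[K[i]]_(n1, n3)) (R14 : 'M[K[i]]_(n1, n4))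
  (R21 : 'M[K[i]]_(n2, n1)) (R22 : 'M[K[i]]_(n2, n2))
  (R23 : 'M[K[i]]_(n2, n3)) (R24 : 'M[K[i]]_(n2, n4))
  (R31 : 'M[K[i]]_(n3, n1)) (R32 : 'M[K[i]]_(n3, n2))
  (R33 : 'M[K[i]]_(n3, n3)) (R34 : 'M[K[i]]_(n3, n4))
  (R41 : 'M[K[i]]_(n4, n1)) (R42 : 'M[K[i]]_(n4, n2))
  (R43 : 'M[K[i]]_(n4, n3)) (R44 : 'M[K[i]]_(n4, n4))
  (hURU : U *m R *m U^t* =
     col4 (row4 R11 R12 R13 R14)
          (row4 R21 R22 R23 R24)
          (row4 R31 R32 R33 R34)
          (row4 R41 R42 R43 R44)) :
  let R0 := col3 (row3 R11 R12 R14)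
                 (row3 R21 R22 R24)
                 (row3 R41 R42 R44) in
  let L3 := row4 L31 L32 L33 L34 in
  let Q2 := col4 Q12 Q22 0 Q42 : 'M[K[i]]_(n, n2) in
  forall (Y1 : 'M[K[i]]_(n3, n1)) (Y2 : 'M[K[i]]_(n3, n2))
         (Y4 : 'M[K[i]]_(n3, n4)),
  let Y := row3 Y1 Y2 Y4 in
  let Yhat := row4 Y1 Y2 0 Y4 : 'M[K[i]]_(n3, n) in
  Y1 \is a mxOver (scalars K F) ->
  Y2 \is a mxOver (scalars K F) ->
  Y4 \is a mxOver (scalars K F) ->
  im_sub (Y^t*) R0 ->
  exists DR : 'M[K[i]]_n,
  exists DJ : 'M[K[i]]_n,
  [/\ [/\ DR \is a mxOver (scalars K F),
          DR = DR^t*,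
          psdmx (R + DR)
        & spectral_norm DR <=
            2 * spectral_norm Y
            + (spectral_norm (invmx (restrict_im R0)) * spectral_norm Y
               + 2 * spectral_norm (invmx (sqrt_psd (restrict_im R0)))
                   * Num.sqrt (spectral_norm Y))
              * (spectral_norm R33 + spectral_norm Y)],
      [/\ DJ \is a mxOver (scalars K F),
          DJ = - DJ^t*
        & frobenius_norm DJ <=
            2 * frobenius_norm (orthoproj_im Q2 *m (L3^t* + Yhat^t*))],
      forall s t : K[i],
        regular_pencil E ((J + s *: DJ - R - t *: DR) *m Q)
        /\ same_nonzero_structure E (L *m Q)
             E ((J + s *: DJ - R - t *: DR) *m Q)
    & zero_semisimple E ((J + DJ - R - DR) *m Q)].
Proof.
move=> R0 L3 Q2 Y1 Y2 Y4 Y Yhat oY1 oY2 oY4 YR0.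
have UU : U *m U^t* = 1%:M by apply/unitarymxP.
have U'U : U^t* *m U = 1%:M by apply: mulmx1C.
have uU : U \in unitmx by apply: unitarymx_unit.
have [e0 e0E] : {e0 | e0 = U^t* *m @sel124 K[i] n1 n2 n3 n4}
  by exists (U^t* *m sel124 n1 n2 n3 n4).
have [e3 e3E] : {e3 | e3 = U^t* *m @sel3 K[i] n1 n2 n3 n4}
  by exists (U^t* *m sel3 n1 n2 n3 n4).
have e0C : e0^t* = (sel124 n1 n2 n3 n4)^t* *m U by rewrite e0E trmxC_mul trmxCK.
have e3C : e3^t* = (sel3 n1 n2 n3 n4)^t* *m U by rewrite e3E trmxC_mul trmxCK.
have conjU m k (A : 'M_(m, n)) (B : 'M_(n, k)) : A *m U *m (U^t* *m B) = A *m B.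
  by rewrite mulmxA -(mulmxA A) UU mulmx1.
have i0 : e0^t* *m e0 = 1%:M by rewrite e0C e0E conjU sel124_1.
have i3 : e3^t* *m e3 = 1%:M by rewrite e3C e3E conjU sel3_1.
have i30 : e3^t* *m e0 = 0 by rewrite e3C e0E conjU sel3_124.
have i1 : e0 *m e0^t* + e3 *m e3^t* = 1%:M.
  rewrite e0C e3C e0E e3E !mulmxA -mulmxDl -!(mulmxA (U^t*)) -mulmxDr.
  by rewrite sel_complete mulmx1.
have R0E : R0 = e0^t* *m R *m e0.
  transitivity ((sel124 n1 n2 n3 n4)^t* *m (U *m R *m U^t*)
                *m sel124 n1 n2 n3 n4).
    by rewrite hURU sel124_mul mul_col3 !mul_sel124.
  by rewrite e0C e0E !mulmxA.
have R33E : R33 = e3^t* *m R *m e3.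
  transitivity ((sel3 n1 n2 n3 n4)^t* *m (U *m R *m U^t*) *m sel3 n1 n2 n3 n4).
    by rewrite hURU sel3_mul mul_sel3.
  by rewrite e3C e3E !mulmxA.
have YhatE : Yhat = Y *m (sel124 n1 n2 n3 n4)^t* by rewrite row3_sel124.
have hYR0 : im_sub (Y^t*) (e0^t* *m R *m e0) by rewrite -R0E.
have [D [hD psdD De0 oD Dle]] := psd_completion F hR0 i0 i3 i30 i1 hYR0.
pose P := orthoproj_im Q2.
have hP : P^t* = P by apply: orthoproj_im_herm.
(* The smallest G in Frobenius norm with (L3 + Yhat + G) Q2 = 0. *)
pose G := - ((L3 + Yhat) *m P).
pose DJ := e3 *m (G *m U) - (e3 *m (G *m U))^t*.
have Psel : P *m sel3 n1 n2 n3 n4 = 0.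
  have [W PE] := orthoproj_im_factor Q2.
  by rewrite -[LHS]trmxCK trmxC_mul hP {1}/P PE mulmxA sel3_mul mul0mx trmxC0.
have Ge3 : G *m U *m e3 = 0.
  by rewrite e3E conjU /G mulNmx -mulmxA Psel mulmx0 oppr0.
have oR : R \is a mxOver (scalars K F).
  rewrite -[R]opprK; apply/overN/over_half.
  have -> : - R + - R = L + L^t*; last exact/overD/over_trC.
  rewrite hJR trmxCD trmxCN -hR addrACA [J + _](_ : _ = 0) ?add0r //.
  by rewrite {1}hJ addNr.
have osel124 : sel124 n1 n2 n3 n4 \is a mxOver (scalars K F).
  by rewrite !(over_col, over_row, over0, over1).
have osel3 : sel3 n1 n2 n3 n4 \is a mxOver (scalars K F).
  by rewrite !(over_col, over0, over1).
have oe0 : e0 \is a mxOver (scalars K F) by rewrite e0E overM ?over_trC.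
have oe3 : e3 \is a mxOver (scalars K F) by rewrite e3E overM ?over_trC.
have oY : Y \is a mxOver (scalars K F) by rewrite !over_row.
have L3E : L3 = (sel3 n1 n2 n3 n4)^t* *m (U *m L *m U^t*).
  by rewrite hULU sel3_mul.
have oL3 : L3 \is a mxOver (scalars K F).
  by rewrite L3E !overM ?over_trC.
have Q2E : Q2 = U *m Q *m X *m (col4 0 1%:M 0 0 : 'M_(n, n2)).
  by rewrite hUQX mul_col4 !mul_row4 !(mul0mx, mulmx0, mulmx1, addr0, add0r).
have oP : P \is a mxOver (scalars K F).
  apply: over_orthoproj_im; rewrite Q2E !overM //.
  by rewrite !(over_col, over0, over1).
have oG : G \is a mxOver (scalars K F).
  by rewrite /G YhatE overN // overM // overD // overM // over_trC.
have oDJ : DJ \is a mxOver (scalars K F).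
  have oGU := overM oe3 (overM oG hUF).
  exact: overD oGU (overN (over_trC oGU)).
(* Q has its image in that of e0, so the perturbations act on Q only through
   their third block row. *)
have e3Q : e3^t* *m Q = 0.
  have : e3^t* *m Q *m X = 0.
    by rewrite e3C -!mulmxA (mulmxA U) hUQX sel3_mul /row4 !row_mx0.
  by move=> /(congr1 (mulmx^~ (invmx X))); rewrite mulmxK // mul0mx.
have DQ : D *m Q = - (e3 *m (Yhat *m U *m Q)).
  rewrite -[Q in LHS]mul1mx -i1 mulmxDl -(mulmxA e3) e3Q mulmx0 addr0.
  by rewrite !mulmxA De0 YhatE e0C !mulNmx !mulmxA.
have DJQ : DJ *m Q = e3 *m (G *m U *m Q).
  by rewrite mulmxBl trmxC_mul -(mulmxA (_^t*)) e3Q mulmx0 subr0 !mulmxA.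
have pertE s t : U *m ((J + s *: DJ - R - t *: D) *m Q) *m X =
    U *m (L *m Q) *m X
    + sel3 n1 n2 n3 n4 *m ((s *: G + t *: Yhat) *m (U *m Q *m X)).
  have -> : J + s *: DJ - R - t *: D = L + (s *: DJ - t *: D).
    by rewrite hJR -!addrA; congr (_ + _); rewrite addrCA.
  have e : (s *: DJ - t *: D) *m Q =
      e3 *m ((s *: G + t *: Yhat) *m (U *m Q)).
    rewrite mulmxBl -!scalemxAl DQ DJQ scalerN opprK !(scalemxAr _ e3) -mulmxDr.
    by rewrite [in RHS]mulmxDl -!scalemxAl !mulmxA.
  rewrite mulmxDl mulmxDr mulmxDl e; congr (_ + _).
  by rewrite e3E !mulmxA UU mul1mx.
have A32E : L3 *m Q2 = A32.
  have : U *m L *m U^t* *m (U *m Q *m X) = U *m (L *m Q) *m X.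
    by rewrite !mulmxA -(mulmxA _ (U^t*)) U'U mulmx1.
  rewrite hULU hUQX hULQX mul_col4 => /col4_inj[_ _ + _].
  rewrite mul_row4 !mul_mx_row4 !add_row4 => /row4_inj[_ <- _ _].
  by rewrite /L3 /Q2 mul_row4.
have pert s t : exists (B31 : 'M_(n3, n1)) (B34 : 'M_(n3, n4)),
    U *m ((J + s *: DJ - R - t *: D) *m Q) *m X =
    col4 (row4 A11 0 0 A14) (row4 A21 0 0 A24)
         (row4 B31 (A32 + (s *: G + t *: Yhat) *m Q2) 0 B34)
         (row4 0 0 0 A44).
  (* The third row of U Q X is zero: K3 has no effect. *)
  have [K1 [K2 [K3 [K4 KE]]]] := row4_split (s *: G + t *: Yhat).
  exists (A31 + (K1 *m Q11 + (K2 *m Q21 + K4 *m Q41))), (A34 + K4).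
  rewrite pertE hULQX KE hUQX /Q2 !mul_row4 !mul_mx_row4 !add_row4.
  rewrite !(mulmx0, mulmx1, addr0, add0r) /sel3 mul_col4 !mul0mx mul1mx.
  by rewrite /col4 !add_col_mx add_row4 !addr0.
have [uE1 uE2] := (hE11.2, hE22.2); have uA1 := hA11.2.
have coords B : pencil_equiv E B (U *m E *m X) (U *m B *m X).
  by exists U, X; split=> //; apply: unitmx_iso.
have [bs hbs] := condensed_kronecker n3 uE1 uE2 uA1 hA44.
exists D, DJ; split.
- split; [exact: oD | by rewrite hD | exact: psdD | by rewrite R0E R33E].
- split=> //.
    by rewrite trmxCD trmxCN trmxCK opprB.
  apply: (le_trans (frobenius_skew i3 Ge3)).
  rewrite frobenius_norm_unitary // frobenius_normN -frobenius_norm_trC.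
  by rewrite trmxC_mul hP trmxCD.
- move=> s t; have [B31 [B34 BE]] := pert s t; split.
    apply: (pencil_equiv_regular (coords _)); rewrite hUEX BE.
    exact: condensed_regular.
  have [[bs1 k1 e1] _] := hbs E21 A14 A21 A24 A31 A32 A34.
  have [[bs2 k2 e2] _] := hbs E21 A14 A21 A24 B31
    (A32 + (s *: G + t *: Yhat) *m Q2) B34.
  exists bs1, bs2; split; last by rewrite e1 e2.
    by apply: (kronecker_form_pencil_equiv (coords _)); rewrite hUEX hULQX.
  by apply: (kronecker_form_pencil_equiv (coords _)); rewrite hUEX BE.
- have [B31 [B34 BE]] := pert 1 1; rewrite !scale1r in BE.
  have [_ hz] := hbs E21 A14 A21 A24 B31 (A32 + (G + Yhat) *m Q2) B34.
  have [bs' k' z'] : zero_semisimple (U *m E *m X)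
      (U *m ((J + DJ - R - D) *m Q) *m X).
    rewrite hUEX BE; apply: hz.
    rewrite mulmxDl /G mulNmx -(mulmxA _ P) orthoproj_im_id mulmxDl A32E.
    by rewrite opprD subrK subrr.
  by exists bs' => //; apply: kronecker_form_pencil_equiv (coords _) k'.
Qed.
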